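(* Let $X\subseteq\mathbb{R}^d$ be a non-empty set. If \[ \sup_{\theta\in[0,1]}\left(\dim_{\mathrm F}^{\theta}X+\dim_{\mathrm F}^{1-\theta}X\right)>d, \] then $\mathcal{L}^1(D(X))>0$. Otherwise \[ \dim_{\mathrm H}D(X)\geq1-d+\sup_{\theta\in[0,1]}\left(\dim_{\mathrm F}^{\theta}X+\dim_{\mathrm F}^{1-\theta}X\right). \]
   Context: The distance set of $X\subseteq\mathbb{R}^d$ is $D(X)=\{|x-y|:x,y\in X\}$. $\mathcal{L}^1$ is 1-dimensional Lebesgue (outer) measure on $\mathbb{R}$ and $\dim_{\mathrm H}$ is Hausdorff dimension. For a finite Borel measure $\mu$ on $\mathbb{R}^d$ write $\widehat\mu(z)=\int e^{-2\pi i z\cdot x}\,d\mu(x)$. For $s\geq 0$ and $\theta\in(0,1]$ let $\mathcal{J}_{s,\theta}(\mu)=\left(\int_{\mathbb{R}^d}|\widehat\mu(z)|^{2/\theta}|z|^{s/\theta-d}\,dz\right)^{\theta}$, and let $\mathcal{J}_{s,0}(\mu)=\sup_{z\in\mathbb{R}^d}|\widehat\mu(z)|^2|z|^s$. The Fourier spectrum of $\mu$ at $\theta\in[0,1]$ is $\dim_{\mathrm F}^{\theta}\mu=\sup\{s\geq 0:\mathcal{J}_{s,\theta}(\mu)<\infty\}\in[0,\infty]$, with $\sup\emptyset=0$. For non-empty $X\subseteq\mathbb{R}^d$, $\dim_{\mathrm F}^{\theta}X=\sup\{\min\{\dim_{\mathrm F}^{\theta}\mu,d\}:\operatorname{spt}(\mu)\subseteq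 X\}$, where the supremum is over non-zero finite Borel measures $\mu$ on $\mathbb{R}^d$ whose (closed) support is contained in $X$. *)

(* Defs.v *)
From HB Require Import structures.
From mathcomp Require Import all_boot all_order all_algebra.
From mathcomp Require Import complex.
From mathcomp Require Import all_classical all_reals all_analysis.
Import Order.TTheory GRing.Theory Num.Theory.
Import numFieldNormedType.Exports.

Set Implicit Arguments.
Unset Strict Implicit.
Unset Printing Implicit Defensive.

Local Open Scope classical_set_scope.
Local Open Scope ring_scope.

Section Euclidean.
Context {R : realType} {d : nat}.
Implicit Types x y : 'rV[R]_d.

Definition dotprod x y : R := \sum_(i < d) x ord0 i * y ord0 i.

(* The library norm on 'rV[R]_d is the sup norm, so the Euclidean norm is
   introduced separately. Both induce the topology of 'rV[R]_d. *)
Definition enorm x : R := Num.sqrt (dotprod x x).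

Definition distance_set (X : set 'rV[R]_d) : set R :=
  [set enorm (p.1 - p.2) | p in X `*` X].

End Euclidean.

(* 'rV[R]_d equipped with its Borel sigma-algebra *)
Notation borelRd R d := (g_sigma_algebraType (@open 'rV[R]_d)).

(* Lebesgue measure on R^d is the image of the d-fold product of
   lebesgue_measure, built by recursion on d over d.-tuple R. *)
Section lebesgue_tuple.
Context {R : realType}.
Local Notation RT := (measurableTypeR R).

Definition tuple_cons (n : nat) (p : n.-tuple RT * RT) : n.+1.-tuple RT :=
  [the n.+1.-tuple RT of p.2 :: p.1].

Lemma measurable_tuple_cons n : measurable_fun [set: _] (@tuple_cons n).
Proof. by apply: measurable_cons. Qed.

HB.instance Definition _ n := @isMeasurableFun.Build _ _ _ _
  (@tuple_cons n) (@measurable_tuple_cons n).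

Section step.
Variables (n : nat) (mu : {measure set (n.-tuple RT) -> \bar R}).

Definition lebesgue_tupleS : set (n.+1.-tuple RT) -> \bar R :=
  pushforward (mu \x @lebesgue_measure R)%E (@tuple_cons n).

Let lebesgue_tupleS0 : lebesgue_tupleS set0 = 0%E.
Proof. by rewrite /lebesgue_tupleS /pushforward preimage_set0 measure0. Qed.

Let lebesgue_tupleS_ge0 A : (0 <= lebesgue_tupleS A)%E.
Proof. exact: measure_ge0. Qed.

Let lebesgue_tupleS_sigma_additive : semi_sigma_additive lebesgue_tupleS.
Proof.
move=> F mF tF mUF; rewrite /lebesgue_tupleS /pushforward preimage_bigcup.
apply: measure_semi_sigma_additive.
- by move=> k; rewrite -[X in measurable X]setTI; exact: measurable_tuple_cons.
- apply/trivIsetP => /= i j _ _ ij; rewrite -preimage_setI.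
  by move/trivIsetP : tF => /(_ _ _ _ _ ij) ->//; rewrite preimage_set0.
- rewrite -preimage_bigcup -[X in measurable X]setTI.
  exact: measurable_tuple_cons.
Qed.

HB.instance Definition _ := isMeasure.Build _ _ _ lebesgue_tupleS
  lebesgue_tupleS0 lebesgue_tupleS_ge0 lebesgue_tupleS_sigma_additive.

End step.

Fixpoint lebesgue_tuple (n : nat) : {measure set (n.-tuple RT) -> \bar R} :=
  match n return {measure set (n.-tuple RT) -> \bar R} with
  | 0 => @dirac _ (0.-tuple RT) [tuple] R
  | n.+1 => lebesgue_tupleS (lebesgue_tuple n)
  end.

Definition row_of_tuple (d : nat) (t : d.-tuple RT) : borelRd R d :=
  \row_(i < d) tnth t i.

Lemma measurable_row_of_tuple d : measurable_fun [set: _] (@row_of_tuple d).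
Proof.
apply: (@measurability _ _ _ (borelRd R d) _ _ (@open 'rV[R]_d)) => // _ [U oU <-]; rewrite setTI.
pose c (p : 'rV[rat]_d * nat) : 'rV[R]_d := map_mx ratr p.1.
pose B (p : 'rV[rat]_d * nat) : set 'rV[R]_d :=
  [set y | forall j, `|c p ord0 j - y ord0 j| < p.2.+1%:R^-1].
have UE : U = \bigcup_p (if `[< B p `<=` U >] then B p else set0).
  apply/seteqP; split => [x Ux|x [p _]]; last by case: asboolP => // BU /BU.
  have /nbhs_ballP[e /= e0 xeU] : nbhs x U by exact: open_nbhs_nbhs.
  have [k ke] : exists k : nat, k.+1%:R^-1 < e / 2.
    have : \forall k \near \oo, k.+1%:R^-1 < e / 2.
      by apply: near_infty_natSinv_lt (PosNum (divr_gt0 e0 (ltr0n _ 2))).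
    by move=> [k _ /(_ k (leqnn _))]; exists k.
  have k0 : 0 < k.+1%:R^-1 :> R by rewrite invr_gt0.
  have /choice[q qP] : forall j, exists q : rat,
      `|ratr q - x ord0 j| < k.+1%:R^-1 :> R.
    move=> j; have [|q] := @rat_in_itvoo R (x ord0 j) (x ord0 j + k.+1%:R^-1).
      by rewrite ltrDl.
    rewrite in_itv/= => /andP[xq qx]; exists q.
    by rewrite ger0_norm ?subr_ge0 ?ltW// ltrBlDl.
  pose p : 'rV[rat]_d * nat := (\row_j q j, k).
  have Bx : B p x by move=> j; rewrite !mxE; exact: qP.
  exists p => //; case: asboolP => // -[] y By; apply: xeU.
  split => // i j; rewrite (ord1 i) -ball_normE /=.
  rewrite (_ : _ - _ = (c p ord0 j - y ord0 j) - (c p ord0 j - x ord0 j)).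
    rewrite (le_lt_trans (ler_normB _ _))// [e]splitr ltrD//.
      by rewrite (lt_trans (By j)).
    by rewrite (lt_trans (Bx j)).
  by rewrite opprB [RHS]addrC addrA subrK.
rewrite UE preimage_bigcup; apply: countable_bigcupT_measurable.
  exact: countableP.
move=> p; case: ifP => _; last by rewrite preimage_set0.
rewrite (_ : _ @^-1` _ = \bigcap_j
    ((fun t => tnth t j) @^-1` ball (c p ord0 j) p.2.+1%:R^-1)); last first.
  apply/seteqP; split => t /= tB j.
    by move=> _; rewrite -ball_normE/= /c; have := tB j; rewrite /c !mxE.
  by have := tB j I; rewrite -ball_normE/= /c !mxE.
apply: fin_bigcap_measurable => // j _; rewrite -[X in measurable X]setTI.
by apply: measurable_tnth => //; exact: measurable_realfun.measurable_ball.
Qed.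

HB.instance Definition _ d := @isMeasurableFun.Build _ _ _ _
  (@row_of_tuple d) (@measurable_row_of_tuple d).

End lebesgue_tuple.

Section lebesgue_Rd.
Context {R : realType}.
Variable d : nat.

Definition lebesgue_Rd : set (borelRd R d) -> \bar R :=
  pushforward (lebesgue_tuple d) (@row_of_tuple R d).

Let lebesgue_Rd0 : lebesgue_Rd set0 = 0%E.
Proof. by rewrite /lebesgue_Rd /pushforward preimage_set0 measure0. Qed.

Let lebesgue_Rd_ge0 A : (0 <= lebesgue_Rd A)%E.
Proof. exact: measure_ge0. Qed.

Let lebesgue_Rd_sigma_additive : semi_sigma_additive lebesgue_Rd.
Proof.
move=> F mF tF mUF; rewrite /lebesgue_Rd /pushforward preimage_bigcup.
apply: measure_semi_sigma_additive.
- by move=> k; rewrite -[X in measurable X]setTI; exact: measurable_row_of_tuple.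
- apply/trivIsetP => /= i j _ _ ij; rewrite -preimage_setI.
  by move/trivIsetP : tF => /(_ _ _ _ _ ij) ->//; rewrite preimage_set0.
- rewrite -preimage_bigcup -[X in measurable X]setTI.
  exact: measurable_row_of_tuple.
Qed.

HB.instance Definition _ := isMeasure.Build _ _ _ lebesgue_Rd
  lebesgue_Rd0 lebesgue_Rd_ge0 lebesgue_Rd_sigma_additive.

End lebesgue_Rd.

Section fourier.
Context {R : realType} {d : nat}.
Implicit Types (mu : {measure set (borelRd R d) -> \bar R}) (z : 'rV[R]_d).
Local Open Scope complex_scope.

(* exp(i t) *)
Definition expi (t : R) : R[i] := cos t +i* sin t.

Definition cintegral mu (f : borelRd R d -> R[i]) : R[i] :=
  (\int[mu]_x complex.Re (f x)) +i* (\int[mu]_x complex.Im (f x)).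

Definition fourier mu z : R[i] :=
  cintegral mu (fun x => expi (- (2 * pi * dotprod z x))).

Definition abs_fourier mu z : R := ComplexField.Normc.normc (fourier mu z).

(* Conventions at z = 0: since 0 `^ 0 = 1, the factor |z|^s is 1 when s = 0;
   since 0 `^ a = 0 for a < 0, the integrand is 0 at the origin rather than
   infinite when s / theta < d, which affects only a Lebesgue-null set. *)
Definition fourier_energy mu (s theta : R) : \bar R :=
  if theta == 0 then
    ereal_sup [set (abs_fourier mu z ^+ 2 * enorm z `^ s)%:E | z in setT]
  else
    ((\int[@lebesgue_Rd R d]_z
        (abs_fourier mu z `^ (2 / theta) *
         enorm z `^ (s / theta - d%:R))%:E) `^ theta)%E.

(* The maximum with 0 implements sup set0 = 0, as ereal_sup set0 = -oo. *)
Definition fourier_spectrum_measure mu (theta : R) : \bar R :=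
  maxe 0%E (ereal_sup
    [set s%:E | s in [set s : R | 0 <= s /\ (fourier_energy mu s theta < +oo)%E]]).

Definition spt mu : set 'rV[R]_d :=
  [set x | forall U : set 'rV[R]_d, open U -> U x -> (0 < mu U)%E].

Definition fourier_spectrum (X : set 'rV[R]_d) (theta : R) : \bar R :=
  ereal_sup [set mine (fourier_spectrum_measure mu theta) d%:R%:E |
    mu in [set mu : {finite_measure set (borelRd R d) -> \bar R} |
             mu setT <> 0%E /\ spt mu `<=` X]].

End fourier.

Section hausdorff.
Context {R : realType}.
Implicit Types (A : set R) (s delta : R).

Definition diam A : \bar R :=
  ereal_sup [set `|p.1 - p.2|%:E | p in A `*` A].

(* |A|^s, with the convention that the empty set has weight 0 for all s. *)
Definition diam_pow s A : \bar R :=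
  if A == set0 then 0%E else (diam A `^ s)%E.

Definition hausdorff_premeasure s delta A : \bar R :=
  ereal_inf [set (\sum_(k <oo) diam_pow s (F k))%E |
    F in [set F : (set R)^nat |
           A `<=` \bigcup_k F k /\ forall k, (diam (F k) <= delta%:E)%E]].

Definition hausdorff_measure s A : \bar R :=
  ereal_sup [set hausdorff_premeasure s delta A |
    delta in [set delta : R | 0 < delta]].

Definition hausdorff_dim A : \bar R :=
  ereal_inf [set s%:E | s in
    [set s : R | 0 <= s /\ hausdorff_measure s A = 0%E]].

End hausdorff.

(* Main.v *)
From HB Require Import structures.
Require Import Defs.
From mathcomp Require Import all_boot all_order all_algebra.
From mathcomp Require Import complex.
From mathcomp Require Import all_classical all_reals all_analysis.
From mathcomp Require Import measurable_realfun.
From mathcomp Require Import ring lra.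
Import Order.TTheory GRing.Theory Num.Theory.
Import numFieldNormedType.Exports.

Local Open Scope classical_set_scope.
Local Open Scope ring_scope.

(* Given measures mu and nu on X, let sigma be the image of mu x nu under
   (x, y) |-> x - y, so that |sigma^|^2 = |mu^|^2 |nu^|^2. Since
   u^theta v^(1-theta) <= u + v, finiteness of J_{a,theta}(mu) and
   J_{b,1-theta}(nu) makes |sigma^(z)|^2 |z|^(a+b-d) integrable at infinity.
   Put p = max(d - a - b, 0), which may be assumed to lie in [0, 1). Because
   e^(-r |x|) has the Cauchy kernel as Fourier transform, the sigma x sigma
   measure of pairs at sup-distance at most r is at most a constant times
   r^d \int e^(-r |z|_1) |sigma^(z)|^2 dz, hence O(r^(d-p)).
   On the cone where z_i is, up to sign, the largest coordinate in absolute
   value, z is determined up to O(1/M) by the integer parts of M |z| and of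
   M z_j for j <> i. By Cauchy-Schwarz over these cells, the squares of the
   masses of the intervals [m/M, (m+1)/M) under z |-> |z| have sum
   O(M^(p-1)). If p = 0, a further application of Cauchy-Schwarz shows that
   null sets carry no mass; in general, discarding for e < 1 - p the dyadic
   intervals of mass more than 2^(-j e) leaves a set of positive mass to which
   the mass distribution principle applies. The image of spt mu x spt nu under
   |x - y| lies in the distance set. *)

Set Implicit Arguments.
Unset Strict Implicit.
Unset Printing Implicit Defensive.

(** * Exponential integrals on the line *)

(** The kernel [e^(-r |x|)] is chosen because it factors over coordinates, has an elementary
    antiderivative against cosines and a positive transform: positivity and Fubini then give the
    correlation bound, without an inversion formula or asymptotics of spherical transforms. The
    obstacle in the radial step is that [|z|] and the coordinates other than [z_i] determine [z_i]
    only through a square root, which is unstable where [z_i] is small. On the cone where [z_i]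
    dominates, the map is uniformly stable, and finitely many cones cover the space. That [p < 1]
    may be assumed comes from arguing by contradiction: if the [e]-dimensional Hausdorff measure of
    the distance set vanishes while [a + b > e - 1 + d], then [d - a - b < 1 - e]. The distance set
    need not be Borel, so it enters only through measurable sets [V] containing it: the image of
    sigma under [|z|] gives no mass to the complement of such a [V], and both conclusions use
    nothing else about it. *)

Section real_line.
Context {R : realType}.
Local Notation leb := (@lebesgue_measure R).
Implicit Types (a t x : R) (f F g : R -> R).

Lemma is_derive_comp f g x (df dg : R) :
  is_derive x 1 f df -> is_derive (f x) 1 g dg ->
  is_derive x 1 (g \o f) (dg * df).
Proof.
move=> [fd fE] [gd gE]; split.
  apply/derivable1_diffP; apply: differentiable_comp.
    by move/derivable1_diffP : fd.
  by move/derivable1_diffP : gd.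
by rewrite -derive1E (derive1_comp fd gd) 2!derive1E fE gE.
Qed.

Lemma ge0_integral_FTCy f F (l : R) :
  (forall x, 0 <= x -> 0 <= f x) -> {within `[0, +oo[, continuous f} ->
  (forall x, 0 <= x -> is_derive x 1 F (f x)) -> F x @[x --> +oo] --> l ->
  (\int[leb]_(x in `[0%R, +oo[) (f x)%:E = (l - F 0)%:E)%E.
Proof.
move=> f0 cf dF Fl; rewrite (ge0_continuous_FTC2y (F := F) (l := l)) ?EFinB//.
- by move=> x x0; have [] := dF x (ltW x0).
- apply: cvg_at_right_filter; have [+ _] := dF 0 (lexx _).
  by move=> /derivable1_diffP/differentiable_continuous.
- move=> x; rewrite in_itv/= andbT => x0.
  by rewrite derive1E; have [_ ->] := dF x (ltW x0).
Qed.

Lemma cvgy0_expR_bounded a f (C : R) : 0 < a -> (forall x, `|f x| <= C) ->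
  expR (- (a * x)) * f x @[x --> +oo] --> 0.
Proof.
move=> a0 fC; apply: norm_cvg0.
have eC : expR (- (a * x)) * C @[x --> +oo] --> (0 : R).
  rewrite -(mul0r C); apply: cvgM; last exact: cvg_cst.
  apply: (@cvg_comp _ _ _ (fun x => a * x) (fun y => expR (- y)) _ (pinfty_nbhs R)).
    exact: gt0_cvgMry.
  exact: cvgr_expR.
apply: (squeeze_cvgr _ (cvg_cst 0) eC); near=> x.
by rewrite normr_ge0/= normrM ger0_norm ?expR_ge0// ler_wpM2l ?expR_ge0.
Unshelve. all: by end_near. Qed.

(** The antiderivative is the real part of [e^((-a + i t) x) / (-a + i t)]. *)
Lemma is_derive_expRcos a t x : 0 < a ->
  is_derive x 1 (fun x => expR (- (a * x)) *
    ((t * sin (t * x) - a * cos (t * x)) / (a ^+ 2 + t ^+ 2)))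
    (expR (- (a * x)) * cos (t * x)).
Proof.
move=> a0; have n0 : a ^+ 2 + t ^+ 2 != 0.
  by rewrite gt_eqF// ltr_wpDr ?sqr_ge0// exprn_gt0.
have dl (c : R) : is_derive x 1 (fun x : R => c * x) c.
  have := is_deriveZ (f := id) c (is_derive_id x (1 : R)).
  by rewrite scaler1.
have dax : is_derive x 1 (fun x => - (a * x)) (- a) by exact: is_deriveN.
have de := is_derive_comp dax (is_derive_expR _).
have ds := is_derive_comp (dl t) (is_derive_sin _).
have dc := is_derive_comp (dl t) (is_derive_cos _).
have dsum := is_deriveB (is_deriveZ t ds) (is_deriveZ a dc).
have := is_deriveM de (is_deriveZ (a ^+ 2 + t ^+ 2)^-1 dsum).
rewrite (_ : (_ * _) = (fun x => expR (- (a * x)) *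
    ((t * sin (t * x) - a * cos (t * x)) / (a ^+ 2 + t ^+ 2)))); last first.
  by apply/funext => y /=; rewrite [RHS]mulrC [in RHS](mulrC _ (_^-1)) [RHS]mulrC.
move=> H; apply: (is_derive_eq H).
rewrite !fctE /= /GRing.scale/=; field.
by [].
Qed.


Let k a x := expR (- (a * `|x|)).

Let continuous_k a : continuous (k a).
Proof.
move=> x; apply: continuous_comp; last exact: continuous_expR.
apply: continuousN; apply: continuousM; first exact: cst_continuous.
exact: norm_continuous.
Qed.

Let continuous_cosM t : continuous (fun x => cos (t * x)).
Proof.
move=> x; apply: continuous_comp; last exact: continuous_cos.
by apply: continuousM; [exact: cst_continuous|exact: cvg_id].
Qed.

Let continuous_sinM t : continuous (fun x => sin (t * x)).
Proof.
move=> x; apply: continuous_comp; last exact: continuous_sin.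
by apply: continuousM; [exact: cst_continuous|exact: cvg_id].
Qed.

Let cos1_ge0 x : 0 <= 1 + cos x.
Proof. by have := cos_geN1 x; lra. Qed.

(** Adding 1 to the cosine makes the integrand nonnegative, so that integrability and value come
    together from the fundamental theorem on the half-line. The case [t = 0] gives the integral of
    the kernel alone, and subtracting it isolates the cosine. *)
Let integral_k1cos a t : 0 < a ->
  (\int[leb]_x (k a x * (1 + cos (t * x)))%:E =
   (2 * (a^-1 + a / (a ^+ 2 + t ^+ 2)))%:E)%E.
Proof.
move=> a0; rewrite ge0_symfun_integralT; last 3 first.
- by move=> x; rewrite mulr_ge0 ?expR_ge0 ?cos1_ge0//.
- move=> x; apply: continuousM; first exact: continuous_k.
  by apply: continuousD; [exact: cst_continuous|exact: continuous_cosM].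
- by move=> x /=; rewrite /k normrN mulrN cosN.
rewrite [RHS]EFinM; congr (_ * _)%E.
rewrite (_ : [set x | 0 <= x] = `[0, +oo[%classic); last first.
  by apply/seteqP; split => x /=; rewrite in_itv/= andbT.
transitivity (\int[leb]_(x in `[0%R, +oo[) (expR (- (a * x)) * cos (0 * x) +
    expR (- (a * x)) * cos (t * x))%:E)%E.
  apply: eq_integral => x; rewrite inE/= in_itv/= andbT => x0.
  by rewrite /k ger0_norm// mul0r cos0 mulr1 mulrDr mulr1.
pose G t x := expR (- (a * x)) *
  ((t * sin (t * x) - a * cos (t * x)) / (a ^+ 2 + t ^+ 2)).
have Gy s : G s x @[x --> +oo] --> 0.
  apply: (@cvgy0_expR_bounded _ _ ((`|s| + `|a|) * `|(a ^+ 2 + s ^+ 2)^-1|)) => // x.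
  rewrite normrM ler_wpM2r// (le_trans (ler_normB _ _))// !normrM.
  by rewrite lerD// ler_piMr// ?sin_max ?cos_max.
transitivity ((0 + 0 - (G 0 \+ G t) 0)%:E); last first.
  congr EFin; rewrite /G /= !mulr0 oppr0 expR0 sin0 cos0 expr0n /= !mulr0 !mulr1.
  rewrite !mul1r !sub0r !addr0 add0r; field.
  by rewrite !gt_eqF// ltr_wpDr ?sqr_ge0// exprn_gt0.
apply: ge0_integral_FTCy.
- move=> x _; rewrite -mulrDr mul0r cos0 mulr_ge0 ?expR_ge0 ?cos1_ge0//.
- have cexp : continuous (fun x : R => expR (- (a * x))).
    move=> x; apply: continuous_comp; last exact: continuous_expR.
    by apply: continuousN; exact: mulrl_continuous.
  have cec s : continuous (fun x : R => expR (- (a * x)) * cos (s * x)).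
    by move=> x; exact: (@continuousM R R (fun x => expR (- (a * x)))
      (fun x => cos (s * x)) x (@cexp x) (@continuous_cosM s x)).
  apply: (@continuous_subspaceT _ _ _ (fun x : R => expR (- (a * x)) * cos (0 * x) +
    expR (- (a * x)) * cos (t * x))) => x.
  exact: (continuousD (cec 0 x) (cec t x)).
- by move=> x _; apply: is_deriveD; exact: is_derive_expRcos.
- by apply: cvgD; exact: Gy.
Qed.

Let integrable_k1cos a t : 0 < a ->
  leb.-integrable setT (fun x => (k a x * (1 + cos (t * x)))%:E).
Proof.
move=> a0; apply/integrableP; split.
  apply/measurable_EFinP; apply: continuous_measurable_fun => x.
  apply: continuousM; first exact: continuous_k.
  by apply: continuousD; [exact: cst_continuous|exact: continuous_cosM].
under eq_integral do rewrite gee0_abs ?lee_fin ?mulr_ge0 ?expR_ge0//.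
by rewrite integral_k1cos// ltry.
Qed.

Lemma integrable_expR_norm a : 0 < a ->
  leb.-integrable setT (fun x => (expR (- (a * `|x|)))%:E).
Proof.
move=> a0; apply: le_integrable (integrable_k1cos 0 a0) => //.
  by apply/measurable_EFinP; apply: continuous_measurable_fun; exact: continuous_k.
move=> x _; rewrite /k mul0r cos0 lee_fin; have k0 := expR_ge0 (- (a * `|x|)).
by rewrite (ger0_norm k0) ger0_norm; lra.
Qed.

Lemma integrable_expR_normM a g : 0 < a -> measurable_fun setT g ->
  (forall x, `|g x| <= 1) ->
  leb.-integrable setT (fun x => (expR (- (a * `|x|)) * g x)%:E).
Proof.
move=> a0 mg g1; apply: le_integrable (integrable_expR_norm a0) => //.
  apply/measurable_EFinP; apply: measurable_funM => //.
  by apply: continuous_measurable_fun; exact: continuous_k.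
move=> x _; rewrite lee_fin normrM ler_piMr//.
Qed.

Lemma Rintegral_expR_norm a : 0 < a ->
  \int[leb]_x expR (- (a * `|x|)) = 2 / a.
Proof.
move=> a0; have := integral_k1cos 0 a0.
under eq_integral do rewrite mul0r cos0 mulrC EFinM.
rewrite integralZl//; last exact: integrable_expR_norm.
rewrite -(fineK (integrable_fin_num _ (integrable_expR_norm a0)))// -EFinM.
move=> -[]; rewrite -/(Rintegral _ _ _) => H.
apply: (@mulfI _ (1 + 1)); first by rewrite gt_eqF.
rewrite H; field.
by rewrite gt_eqF.
Qed.

Lemma Rintegral_expR_norm_cos a t : 0 < a ->
  \int[leb]_x (expR (- (a * `|x|)) * cos (t * x)) = 2 * a / (a ^+ 2 + t ^+ 2).
Proof.
move=> a0; have := integral_k1cos t a0.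
have ic : leb.-integrable setT (fun x => (expR (- (a * `|x|)) * cos (t * x))%:E).
  apply: integrable_expR_normM => //.
    by apply: continuous_measurable_fun; exact: continuous_cosM.
  by move=> x; exact: cos_max.
under eq_integral do rewrite mulrDr mulr1 EFinD.
rewrite integralD//; last exact: integrable_expR_norm.
rewrite -(fineK (integrable_fin_num _ (integrable_expR_norm a0)))//.
rewrite -(fineK (integrable_fin_num _ ic))// -EFinD => -[].
rewrite -!/(Rintegral _ _ _) Rintegral_expR_norm// mulrDr => /addrI ->.
by rewrite mulrA.
Qed.

Lemma Rintegral_expR_norm_sin a t : 0 < a ->
  \int[leb]_x (expR (- (a * `|x|)) * sin (t * x)) = 0.
Proof.
move=> a0; set f := fun x => _.
have msin : measurable_fun setT (fun x => sin (t * x)).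
  by apply: continuous_measurable_fun; exact: continuous_sinM.
have fi : leb.-integrable setT (EFin \o f).
  by apply: integrable_expR_normM => // x; exact: sin_max.
have fN x : f (- x) = - f x by rewrite /f normrN mulrN sinN mulrN.
have mN : measurable_fun setT (-%R : measurableTypeR R -> measurableTypeR R).
  exact: oppr_measurable.
have : (\int[leb]_x (f x)%:E = \int[leb]_x (f (- x))%:E)%E.
  rewrite -[RHS](integral_pushforward mN (f := EFin \o f) (D := setT))//.
  - by apply: eq_measure_integral => A mA _; exact: esym (lebesgue_measureN mA).
  - by apply/measurable_EFinP; case/integrableP: fi => /measurable_EFinP.
  - rewrite preimage_setT; under [X in _.-integrable _ X]funext do rewrite /= fN EFinN.
    exact: integrableN.
under [in RHS]eq_integral do rewrite fN EFinN.
rewrite integralN//; last first.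
  by rewrite fin_num_adde_defr// integrable_pos_fin_num.
rewrite -(fineK (integrable_fin_num _ fi))// -EFinN => -[].
move=> H; have {H} : Rintegral leb setT f = - Rintegral leb setT f := H.
by lra.
Qed.

Lemma integral_powR_norm_lty (e : R) : 0 < e ->
  (\int[leb]_x ((1 + `|x|) `^ (- (1 + e)))%:E < +oo)%E.
Proof.
move=> e0; pose f (x : R) : R := (1 + `|x|) `^ (- (1 + e)).
have cf : continuous f.
  move=> x; apply: (@continuous_comp R R R (fun x => 1 + `|x|) (fun y => y `^ (- (1 + e)))).
    apply: continuousD; [exact: cst_continuous|exact: norm_continuous].
  have x0 : 0 < 1 + `|x| by rewrite ltr_pwDl.
  have [/derivable1_diffP/differentiable_continuous + _] :=
    is_derive1_powR (- (1 + e)) x0.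
  exact.
rewrite (ge0_symfun_integralT _ cf); last 2 first.
- by move=> x; exact: powR_ge0.
- by move=> x; rewrite /f/= normrN.
rewrite (_ : [set x | 0 <= x] = `[0, +oo[%classic); last first.
  by apply/seteqP; split => x /=; rewrite in_itv/= andbT.
rewrite lte_mul_pinfty// ?lee_fin//.
suff -> : (\int[leb]_(x in `[0%R, +oo[) (f x)%:E =
    (0 - (fun x : R => - (e^-1 * (1 + x) `^ (- e))) 0)%:E)%E by exact: ltry.
apply: (ge0_integral_FTCy (F := fun x : R => - (e^-1 * (1 + x) `^ (- e)))).
- by move=> x _; exact: powR_ge0.
- exact: continuous_subspaceT.
- move=> x x0; have x1 : 0 < 1 + x by rewrite ltr_pwDl.
  have d1 : is_derive x 1 (fun x : R => 1 + x) 1.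
    have := is_deriveD (is_derive_cst (1 : R) x (1 : R)) (is_derive_id x (1 : R)).
    by rewrite add0r.
  have := is_deriveN (is_deriveZ e^-1 (is_derive_comp d1 (is_derive1_powR (- e) x1))).
  move=> H; apply: (is_derive_eq H); rewrite /f /GRing.scale/= ger0_norm// opprD.
  rewrite (addrC (- e)) mulr1; field.
  by rewrite gt_eqF.
- rewrite -[X in _ --> X](oppr0); apply: cvgN; rewrite -(mulr0 e^-1).
  apply: cvgM; first exact: cvg_cst.
  apply: (@cvg_trans _ (expR (- (e * ln (1 + x))) @[x --> +oo])).
    apply: near_eq_cvg; near=> x; rewrite /powR gt_eqF ?mulNr//.
    by rewrite ltr_pwDl//; near: x; exact: nbhs_pinfty_ge.
  apply: (@cvg_comp _ _ _ (fun x => e * ln (1 + x)) (fun y => expR (- y)) _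
    (pinfty_nbhs R)); last exact: cvgr_expR.
  apply: gt0_cvgMry => //.
  apply/cvgryPge => A; near=> x.
  rewrite -[A]expRK ler_ln ?posrE ?expR_gt0//; last first.
    by rewrite ltr_pwDl//; near: x; exact: nbhs_pinfty_ge.
  rewrite -lerBlDl.
  near: x; apply: nbhs_pinfty_ge; exact: num_real.
Unshelve. all: by end_near. Qed.

End real_line.

(** * Products and Lebesgue measure on R^d *)

Section product_integral.
Context d1 d2 (T1 : measurableType d1) (T2 : measurableType d2) (R : realType).
Variables (m1 : {sigma_finite_measure set T1 -> \bar R})
          (m2 : {sigma_finite_measure set T2 -> \bar R}).

Lemma ge0_integral_prodM (f : T1 -> \bar R) (g : T2 -> \bar R) :
  measurable_fun setT f -> measurable_fun setT g ->
  (forall x, 0 <= f x)%E -> (forall x, 0 <= g x)%E ->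
  (\int[(m1 \x m2)%E]_z (f z.1 * g z.2) = (\int[m1]_x f x) * \int[m2]_y g y)%E.
Proof.
move=> mf mg f0 g0; rewrite fubini_tonelli1; last 2 first.
- by apply: emeasurable_funM; apply: measurableT_comp.
- by move=> z; rewrite mule_ge0.
rewrite /fubini_F/=; under eq_integral do rewrite ge0_integralZl//.
by rewrite ge0_integralZr// integral_ge0.
Qed.

Lemma integrable_prodM (f : T1 -> R) (g : T2 -> R) :
  m1.-integrable setT (EFin \o f) -> m2.-integrable setT (EFin \o g) ->
  (m1 \x m2)%E.-integrable setT (fun z => (f z.1 * g z.2)%:E).
Proof.
move=> fi gi; have mf := measurable_int _ fi; have mg := measurable_int _ gi.
apply/integrableP; split.
  by under eq_fun do rewrite EFinM; apply: emeasurable_funM;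
    [exact: (measurableT_comp mf)|exact: (measurableT_comp mg)].
under eq_integral do rewrite abse_EFin normrM EFinM -!abse_EFin.
rewrite (@ge0_integral_prodM (abse \o (EFin \o f)) (abse \o (EFin \o g)))//=.
- have /integrableP[_ fi'] := fi; have /integrableP[_ gi'] := gi.
  by rewrite lte_mul_pinfty// ?integral_ge0// ge0_fin_numE ?integral_ge0.
- exact: measurableT_comp.
- exact: measurableT_comp.
Qed.

Lemma Rintegral_prodM (f : T1 -> R) (g : T2 -> R) :
  m1.-integrable setT (EFin \o f) -> m2.-integrable setT (EFin \o g) ->
  \int[(m1 \x m2)%E]_z (f z.1 * g z.2) = (\int[m1]_x f x) * \int[m2]_y g y.
Proof.
move=> fi gi; have I := integrable_prodM fi gi.
rewrite /Rintegral -(integral12_prod_meas1 I) /fubini_F/=.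
under eq_integral do (under eq_integral do rewrite EFinM; rewrite integralZl//
  -(fineK (integrable_fin_num _ gi))//).
by rewrite integralZr// fineM ?(integrable_fin_num measurableT fi).
Qed.

End product_integral.

Section borel_Rd.
Context {R : realType} {d : nat}.
Local Notation E := (borelRd R d).

Lemma measurable_coord (i : 'I_d) :
  measurable_fun setT (fun x : E => x ord0 i : R).
Proof.
apply: (measurability _ (RGenOInfty.measurableE R)) => //.
move=> _ [_ [a ->] <-]; rewrite setTI; apply: sub_sigma_algebra.
have := @coord_continuous R 1 d ord0 i.
by move/continuousP; apply; exact: interval_open.
Qed.

Lemma measurable_rowP d' (T : measurableType d') (f : T -> E) :
  (forall i, measurable_fun setT (fun t => f t ord0 i : R)) ->
  measurable_fun setT f.
Proof.
move=> mf; pose g t : d.-tuple (measurableTypeR R) := [tuple f t ord0 i | i < d].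
have -> : f = @row_of_tuple R d \o g.
  by apply/funext => t; apply/rowP => i; rewrite mxE tnth_mktuple.
apply: measurableT_comp => //; apply/measurable_fun_tnthP => i.
rewrite (_ : _ \o g = (fun t => f t ord0 i)); first exact: mf.
by apply/funext => t /=; rewrite tnth_mktuple.
Qed.

Lemma measurable_dotprod d' (T : measurableType d') (f g : T -> E) :
  measurable_fun setT f -> measurable_fun setT g ->
  measurable_fun setT (fun t => dotprod (f t) (g t)).
Proof.
move=> mf mg; apply: measurable_sum => i.
apply: measurable_funM.
  exact: (measurableT_comp (measurable_coord i) mf).
exact: (measurableT_comp (measurable_coord i) mg).
Qed.

Lemma measurable_enorm d' (T : measurableType d') (f : T -> E) :
  measurable_fun setT f -> measurable_fun setT (fun t => enorm (f t)).
Proof.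
move=> mf; apply: measurableT_comp (measurable_dotprod mf mf).
by apply: continuous_measurable_fun; exact: sqrt_continuous.
Qed.

Lemma measurable_rowB d' (T : measurableType d') (f g : T -> E) :
  measurable_fun setT f -> measurable_fun setT g ->
  measurable_fun setT (fun t => f t - g t : E).
Proof.
move=> mf mg; apply: measurable_rowP => i; under eq_fun do rewrite mxE mxE.
apply: measurable_funB.
  exact: (measurableT_comp (measurable_coord i) mf).
exact: (measurableT_comp (measurable_coord i) mg).
Qed.

End borel_Rd.

Section lebesgue_tuple.
Context {R : realType}.
Local Notation RT := (measurableTypeR R).
Local Notation leb := (@lebesgue_measure R).

Let cube n (k : nat) : set (n.-tuple RT) := [set t | forall i, `|tnth t i| <= k%:R].

Let measurable_cube n k : measurable (@cube n k).
Proof.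
rewrite (_ : cube k = \bigcap_i ((fun t => tnth t i) @^-1` `[- k%:R, k%:R])).
  apply: fin_bigcap_measurable => // i _; rewrite -[X in measurable X]setTI.
  exact: measurable_tnth.
apply/seteqP; split => t /= tk i; last by rewrite ler_norml; have := tk i I; rewrite /= in_itv.
by move=> _; rewrite /= in_itv/= -ler_norml.
Qed.

Let tnth_cons0 n (p : n.-tuple RT * RT) : tnth (tuple_cons p) ord0 = p.2.
Proof. by []. Qed.

Let tnth_consS n (p : n.-tuple RT * RT) (i : 'I_n) :
  tnth (tuple_cons p) (lift ord0 i) = tnth p.1 i.
Proof. by rewrite tnthS. Qed.

Lemma sigma_finite_lebesgue_tuple n : sigma_finite setT (@lebesgue_tuple R n).
Proof.
exists (@cube n); last first.
  move=> k; split; first exact: measurable_cube.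
  elim: n => [|n ih]; first by rewrite /= diracE; case: (_ \in _); rewrite ltry.
  rewrite /= /lebesgue_tupleS /pushforward.
  rewrite (_ : _ @^-1` _ = cube k `*` `[- k%:R, k%:R]); last first.
    apply/seteqP; split => -[p x] /=.
      move=> H; split => /=; last by rewrite in_itv/= -ler_norml; exact: (H ord0).
      by move=> i; have := H (lift ord0 i); rewrite tnth_consS.
    move=> [/= H1 H2] i; case: (unliftP ord0 i) => [j|] ->.
      by rewrite tnth_consS.
    by rewrite tnth_cons0 ler_norml; move: H2; rewrite in_itv.
  rewrite product_measure1E//; last exact: measurable_cube.
  rewrite /= lebesgue_measure_itv/= lte_fin; case: ifP => _.
    by rewrite -EFinB lte_mul_pinfty// ?ge0_fin_numE ?ltry.
  by rewrite mule0.
apply/seteqP; split => // t _.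
pose m : R := \sum_i `|tnth t i|.
exists (Num.truncn m).+1 => //= i; apply: (@le_trans _ _ m).
  by rewrite /m (bigD1 i)//= lerDl sumr_ge0.
by rewrite ltW// truncnS_gt.
Qed.

(* A copy of [lebesgue_tuple], whose fixpoint cannot carry the sigma-finite
   instance needed for Fubini. *)
Definition lebesgue_tuple_sf n : set (n.-tuple RT) -> \bar R := lebesgue_tuple n.

HB.instance Definition _ n := Measure.copy (@lebesgue_tuple_sf n) (lebesgue_tuple n).

HB.instance Definition _ n := Measure_isSigmaFinite.Build _ _ _
  (@lebesgue_tuple_sf n) (@sigma_finite_lebesgue_tuple n).

Lemma integrable_tuple_cons n (f : n.+1.-tuple RT -> R) :
  measurable_fun setT f ->
  (lebesgue_tuple_sf (n := n) \x leb)%E.-integrable setT (fun p => (f (tuple_cons p))%:E) ->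
  (lebesgue_tuple_sf (n := n.+1)).-integrable setT (EFin \o f).
Proof.
move=> mf fi; have /measurable_EFinP mf' := mf.
have := @integrable_pushforward _ _ _ _ _ _ (@measurable_tuple_cons R n)
  _ setT _ mf' fi measurableT.
by move=> /integrableP[_ H]; apply/integrableP; split.
Qed.

Lemma integral_tuple_cons n (f : n.+1.-tuple RT -> R) :
  measurable_fun setT f ->
  (lebesgue_tuple_sf (n := n) \x leb)%E.-integrable setT (fun p => (f (tuple_cons p))%:E) ->
  \int[lebesgue_tuple_sf (n := n.+1)]_t f t =
  \int[(lebesgue_tuple_sf (n := n) \x leb)%E]_p f (tuple_cons p).
Proof.
move=> mf fi; have /measurable_EFinP mf' := mf.
rewrite /Rintegral; congr fine.
have := @integral_pushforward _ _ _ _ _ _ (@measurable_tuple_cons R n)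
  _ setT _ mf' fi measurableT.
by rewrite preimage_setT => <-; apply: eq_measure_integral.
Qed.

Let measurable_tupleT n (f : 'I_n -> R -> R) : (forall i, measurable_fun setT (f i)) ->
  measurable_fun setT (fun t : n.-tuple RT => \prod_i f i (tnth t i)).
Proof.
move=> mf; apply: measurable_prod => i _.
exact: (measurableT_comp (mf i) (measurable_tnth i)).
Qed.

Lemma integrable_tuple_prod n (f : 'I_n -> R -> R) :
  (forall i, leb.-integrable setT (EFin \o f i)) ->
  (lebesgue_tuple_sf (n := n)).-integrable setT
    (fun t => (\prod_i f i (tnth t i))%:E).
Proof.
elim: n f => [|n ih] f fi.
  under eq_fun do rewrite big_ord0.
  apply/integrableP; split => //.
  under eq_integral do rewrite abse1.
  by rewrite integral_cst// mul1e/= /lebesgue_tuple_sf/= diracT ltry.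
have mf i : measurable_fun setT (f i).
  by apply/measurable_EFinP; exact: measurable_int (fi i).
apply: integrable_tuple_cons; first exact: measurable_tupleT.
have := integrable_prodM (ih (fun i => f (lift ord0 i)) (fun i => fi (lift ord0 i))) (fi ord0).
congr (_.-integrable _ _); apply/funext => -[p x].
rewrite big_ord_recl tnth_cons0 mulrC/=; congr (_ * _)%:E.
by apply: eq_bigr => i _; rewrite tnth_consS.
Qed.

Let W n a (t : n.-tuple RT) : R := \prod_i expR (- (a * `|tnth t i|)).
Let ph n (s : 'I_n -> R) (t : n.-tuple RT) : R := \sum_i s i * tnth t i.

Let mph n s : measurable_fun setT (@ph n s).
Proof.
apply: measurable_sum => i.
exact: (measurableT_comp (mulrl_measurable _) (measurable_tnth i)).
Qed.

Let mcos : measurable_fun setT (@cos R).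
Proof. by apply: continuous_measurable_fun; exact: continuous_cos. Qed.
Let msin : measurable_fun setT (@sin R).
Proof. by apply: continuous_measurable_fun; exact: continuous_sin. Qed.

Let mW n a : measurable_fun setT (@W n a).
Proof.
apply: (@measurable_tupleT n (fun _ x => expR (- (a * `|x|)))) => _; apply: measurableT_comp => //.
by apply: measurable_funN; apply: measurable_funM.
Qed.

Let iW n a (g : n.-tuple RT -> R) : 0 < a -> measurable_fun setT g ->
  (forall t, `|g t| <= 1) ->
  (lebesgue_tuple_sf (n := n)).-integrable setT (fun t => (W a t * g t)%:E).
Proof.
move=> a0 mg g1.
apply: le_integrable (integrable_tuple_prod (fun _ => integrable_expR_norm a0)) => //.
  by apply/measurable_EFinP; apply: measurable_funM => //; exact: mW.
by move=> t _; rewrite lee_fin normrM ler_piMr.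
Qed.

(** The two integrals are the real and imaginary parts of one Fourier integral. They are proved
    together because the addition formulas mix cosine and sine when a coordinate is split off. *)
Lemma integral_tuple_expR_norm n (a : R) (s : 'I_n -> R) : 0 < a ->
  \int[lebesgue_tuple_sf (n := n)]_t (W a t * cos (ph s t)) =
    \prod_i (2 * a / (a ^+ 2 + s i ^+ 2)) /\
  \int[lebesgue_tuple_sf (n := n)]_t (W a t * sin (ph s t)) = 0.
Proof.
move=> a0; elim: n s => [|n ih] s.
  split; rewrite /W /ph; under eq_Rintegral do rewrite !big_ord0 mul1r.
    rewrite cos0 /Rintegral integral_cst// mul1e big_ord0 -[RHS]/(fine 1%E); congr fine.
    by rewrite /= /lebesgue_tuple_sf/= diracT.
  by rewrite sin0 /Rintegral integral_cst// mul0e.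
have [ihc ihs] := ih (fun i => s (lift ord0 i)).
pose s' := fun i => s (lift ord0 i).
have Wc p : W a (@tuple_cons R n p) = W a p.1 * expR (- (a * `|p.2|)).
  rewrite /W big_ord_recl tnth_cons0 mulrC; congr (_ * _).
  by apply: eq_bigr => i _; rewrite tnth_consS.
have phc p : ph s (@tuple_cons R n p) = ph s' p.1 + s ord0 * p.2.
  rewrite /ph big_ord_recl tnth_cons0 addrC; congr (_ + _).
  by apply: eq_bigr => i _; rewrite tnth_consS.
have iWc := iW a0 (measurableT_comp mcos (mph s')) (fun t => cos_max _).
have iWs := iW a0 (measurableT_comp msin (mph s')) (fun t => sin_max _).
have iec := integrable_expR_normM a0 (measurableT_comp mcos (@mulrl_measurable R setT (s ord0)))
  (fun t => cos_max _).
have ies := integrable_expR_normM a0 (measurableT_comp msin (@mulrl_measurable R setT (s ord0)))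
  (fun t => sin_max _).
have icc := integrable_prodM iWc iec. have iss := integrable_prodM iWs ies.
have isc := integrable_prodM iWs iec. have ics := integrable_prodM iWc ies.
split.
- pose F (p : n.-tuple RT * RT) : R :=
    (W a p.1 * cos (ph s' p.1)) * (expR (- (a * `|p.2|)) * cos (s ord0 * p.2)) -
    (W a p.1 * sin (ph s' p.1)) * (expR (- (a * `|p.2|)) * sin (s ord0 * p.2)).
  have FE p : W a (tuple_cons p) * cos (ph s (tuple_cons p)) = F p.
    by rewrite Wc phc cosD /F; ring.
  rewrite integral_tuple_cons; last 2 first.
  + by apply: measurable_funM; [exact: mW|exact: (measurableT_comp mcos (mph s))].
  + by under eq_fun do rewrite FE EFinB; exact: integrableB.
  under eq_Rintegral do rewrite FE.
  rewrite /F RintegralB// (Rintegral_prodM iWc iec) (Rintegral_prodM iWs ies) ihc ihs mul0r subr0.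
  by rewrite Rintegral_expR_norm_cos// big_ord_recl mulrC.
- pose F (p : n.-tuple RT * RT) : R :=
    (W a p.1 * sin (ph s' p.1)) * (expR (- (a * `|p.2|)) * cos (s ord0 * p.2)) +
    (W a p.1 * cos (ph s' p.1)) * (expR (- (a * `|p.2|)) * sin (s ord0 * p.2)).
  have FE p : W a (tuple_cons p) * sin (ph s (tuple_cons p)) = F p.
    by rewrite Wc phc sinD /F; ring.
  rewrite integral_tuple_cons; last 2 first.
  + by apply: measurable_funM; [exact: mW|exact: (measurableT_comp msin (mph s))].
  + by under eq_fun do rewrite FE EFinD; exact: integrableD.
  under eq_Rintegral do rewrite FE.
  rewrite /F RintegralD// (Rintegral_prodM iWs iec) (Rintegral_prodM iWc ies) ihs mul0r add0r.
  by rewrite Rintegral_expR_norm_sin// mulr0.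
Qed.

End lebesgue_tuple.

Section lebesgue_Rd.
Context {R : realType} {d : nat}.
Local Notation E := (borelRd R d).
Local Notation leb := (@lebesgue_measure R).
Local Notation lebd := (@lebesgue_Rd R d).

Lemma measurable_row_normr_le (k : R) : measurable [set z : E | forall i, `|z ord0 i| <= k].
Proof.
rewrite (_ : mkset _ = \bigcap_i ((fun z : E => z ord0 i) @^-1` `[- k, k])).
  apply: fin_bigcap_measurable => // i _; rewrite -[X in measurable X]setTI.
  exact: measurable_coord.
apply/seteqP; split => t /= tk i; last by rewrite ler_norml; have := tk i I; rewrite /= in_itv.
by move=> _; rewrite /= in_itv/= -ler_norml.
Qed.

Let sigma_finite_lebesgue_Rd : sigma_finite setT lebd.
Proof.
have [F FT Foo] := @sigma_finite_lebesgue_tuple R d.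
pose g (x : E) : d.-tuple (measurableTypeR R) := [tuple x ord0 i | i < d].
have gK : cancel (@row_of_tuple R d) g.
  by move=> t; apply: eq_from_tnth => i; rewrite tnth_mktuple mxE.
have mg : measurable_fun setT g.
  apply/measurable_fun_tnthP => i.
  rewrite (_ : _ \o g = (fun x => x ord0 i)); first exact: measurable_coord.
  by apply/funext => t /=; rewrite tnth_mktuple.
exists (fun k => g @^-1` F k).
  by rewrite -preimage_bigcup -FT preimage_setT.
move=> k; have [mF Fk] := Foo k; split.
  by rewrite -[X in measurable X]setTI; exact: mg.
rewrite /lebesgue_Rd /pushforward -comp_preimage.
by rewrite (_ : g \o _ = id)//; apply/funext => t /=; rewrite gK.
Qed.

HB.instance Definition _ := Measure_isSigmaFinite.Build _ _ _ lebd sigma_finite_lebesgue_Rd.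

Lemma integrable_lebesgue_Rd (f : E -> R) : measurable_fun setT f ->
  (lebesgue_tuple_sf (n := d)).-integrable setT (fun t => (f (row_of_tuple t))%:E) ->
  lebd.-integrable setT (EFin \o f).
Proof.
move=> mf fi; have /measurable_EFinP mf' := mf.
have := @integrable_pushforward _ _ _ _ _ _ (@measurable_row_of_tuple R d)
  _ setT _ mf' fi measurableT.
by move=> /integrableP[_ H]; apply/integrableP; split.
Qed.

Lemma Rintegral_lebesgue_Rd (f : E -> R) : measurable_fun setT f ->
  (lebesgue_tuple_sf (n := d)).-integrable setT (fun t => (f (row_of_tuple t))%:E) ->
  \int[lebd]_x f x = \int[lebesgue_tuple_sf (n := d)]_t f (row_of_tuple t).
Proof.
move=> mf fi; have /measurable_EFinP mf' := mf.
rewrite /Rintegral; congr fine.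
have := @integral_pushforward _ _ _ _ _ _ (@measurable_row_of_tuple R d)
  _ setT _ mf' fi measurableT.
by rewrite preimage_setT => <-; apply: eq_measure_integral.
Qed.

Lemma measurable_row_prod (f : R -> R) : measurable_fun setT f ->
  measurable_fun setT (fun z : E => \prod_i f (z ord0 i)).
Proof.
move=> mf; apply: measurable_prod => i _.
exact: (measurableT_comp mf (measurable_coord i)).
Qed.

Lemma integrable_row_prod (f : R -> R) : leb.-integrable setT (EFin \o f) ->
  lebd.-integrable setT (fun z => (\prod_i f (z ord0 i))%:E).
Proof.
move=> fi; apply: integrable_lebesgue_Rd.
  by apply: measurable_row_prod; apply/measurable_EFinP; exact: measurable_int fi.
have := integrable_tuple_prod (fun _ : 'I_d => fi).
congr (_.-integrable _ _); apply/funext => t; congr EFin.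
by apply: eq_bigr => i _; rewrite mxE.
Qed.

(** This is [e^(-a |z|_1)], kept as a product so that its transform is computed one coordinate at a
    time. *)
Definition expRn (a : R) (z : E) : R := \prod_i expR (- (a * `|z ord0 i|)).

Lemma expRn_ge0 a z : 0 <= expRn a z.
Proof. by apply: prodr_ge0 => i _; exact: expR_ge0. Qed.

Lemma measurable_expRn a : measurable_fun setT (expRn a).
Proof.
apply: (@measurable_row_prod (fun x => expR (- (a * `|x|)))).
apply: measurableT_comp => //; apply: measurable_funN.
by apply: measurable_funM.
Qed.

Lemma integrable_expRn a : 0 < a -> lebd.-integrable setT (EFin \o expRn a).
Proof. by move=> a0; exact: (integrable_row_prod (integrable_expR_norm a0)). Qed.

Lemma measurable_cos : measurable_fun setT (@cos R).
Proof. by apply: continuous_measurable_fun; exact: continuous_cos. Qed.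

Lemma measurable_sin : measurable_fun setT (@sin R).
Proof. by apply: continuous_measurable_fun; exact: continuous_sin. Qed.

Lemma Rintegral_expRn_cos a (c : R) (x : E) : 0 < a ->
  \int[lebd]_z (expRn a z * cos (c * dotprod z x)) =
  \prod_i (2 * a / (a ^+ 2 + (c * x ord0 i) ^+ 2)).
Proof.
move=> a0; have [<- _] := integral_tuple_expR_norm (fun i => c * x ord0 i) a0.
have pE (t : d.-tuple (measurableTypeR R)) :
    expRn a (row_of_tuple t) * cos (c * dotprod (row_of_tuple t) x) =
    \prod_i expR (- (a * `|tnth t i|)) * cos (\sum_i c * x ord0 i * tnth t i).
  congr (_ * cos _); first by apply: eq_bigr => i _; rewrite mxE.
  by rewrite mulr_sumr; apply: eq_bigr => i _; rewrite mxE; ring.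
have mp : measurable_fun setT (fun z : E => cos (c * dotprod z x)).
  apply: (measurableT_comp measurable_cos); apply: measurable_funM => //.
  by apply: measurable_dotprod => //; exact: measurable_cst.
have mf : measurable_fun setT (fun z : E => expRn a z * cos (c * dotprod z x)).
  by apply: measurable_funM => //; exact: measurable_expRn.
rewrite Rintegral_lebesgue_Rd//.
  by apply: eq_Rintegral => t _; rewrite pE.
apply: le_integrable (integrable_tuple_prod (fun _ => integrable_expR_norm a0)) => //.
  apply/measurable_EFinP; apply: measurableT_comp mf _ => //.
move=> t _; rewrite lee_fin pE normrM ler_piMr// cos_max//.
Qed.

End lebesgue_Rd.

(** * Fourier transforms of difference measures *)

Lemma integrable_le1 d (T : measurableType d) (R : realType)
    (m : {measure set T -> \bar R}) (f : T -> R) :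
  (m setT < +oo)%E -> measurable_fun setT f -> (forall x, `|f x| <= 1) ->
  m.-integrable setT (EFin \o f).
Proof.
move=> moo mf f1; apply: measurable_bounded_integrable => //.
exists 1; split; first exact: num_real.
by move=> M M1 x _; exact: le_trans (f1 x) (ltW M1).
Qed.

Lemma lty_product_measure d1 d2 (T1 : measurableType d1) (T2 : measurableType d2)
    (R : realType) (m1 : {finite_measure set T1 -> \bar R})
    (m2 : {finite_measure set T2 -> \bar R}) :
  ((m1 \x m2) setT < +oo)%E.
Proof.
rewrite -setXTT product_measure1E// lte_mul_pinfty//.
- exact: fin_num_measure.
- by rewrite ltey_eq fin_num_measure.
Qed.

Lemma measurable_integral_param d1 d2 (T1 : measurableType d1) (T2 : measurableType d2)
    (R : realType) (m : {finite_measure set T2 -> \bar R}) (f : T1 * T2 -> R) :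
  measurable_fun setT f -> (forall x, `|f x| <= 1) ->
  measurable_fun setT (fun x => \int[m]_y f (x, y)).
Proof.
move=> mf f1; have [[a _]|a0] := pselect (exists a : T1, True); last first.
  by move=> _ B mB; rewrite (_ : _ `&` _ = set0)//; apply/seteqP; split => // x; case: a0; exists x.
(* The Dirac mass only serves to make f integrable on the product. *)
have I : (dirac a \x m)%E.-integrable setT (EFin \o f).
  apply: integrable_le1 => //; exact: lty_product_measure.
apply: measurableT_comp (measurable_fubini_F I) => //.
Qed.

(* The canonical sigma-finite structure of [m1 \x m2] in the library is only
   found for subprobabilities. *)
Section finite_product.
Context d1 d2 (T1 : measurableType d1) (T2 : measurableType d2) (R : realType).
Variables (m1 : {finite_measure set T1 -> \bar R})
          (m2 : {finite_measure set T2 -> \bar R}).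

Definition finite_prod : set (T1 * T2) -> \bar R := (m1 \x m2)%E.

Let finite_prod0 : finite_prod set0 = 0%E.
Proof. exact: measure0. Qed.

Let finite_prod_ge0 B : (0 <= finite_prod B)%E.
Proof. exact: measure_ge0. Qed.

Let finite_prod_sigma_additive : semi_sigma_additive finite_prod.
Proof. exact: measure_semi_sigma_additive. Qed.

HB.instance Definition _ := isMeasure.Build _ _ _ finite_prod
  finite_prod0 finite_prod_ge0 finite_prod_sigma_additive.

Let finite_prod_fin : fin_num_fun finite_prod.
Proof. by apply: lty_fin_num_fun; exact: (lty_product_measure m1 m2). Qed.

HB.instance Definition _ := Measure_isFinite.Build _ _ _ finite_prod finite_prod_fin.

Lemma Rintegral_finite_prod (f : T1 * T2 -> R) :
  \int[finite_prod]_p f p = \int[(m1 \x m2)%E]_p f p.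
Proof. by rewrite /Rintegral; congr fine; apply: eq_measure_integral. Qed.

End finite_product.

Section diff_measure.
Context {R : realType} {d : nat}.
Local Notation E := (borelRd R d).

Definition rowB (p : E * E) : E := p.1 - p.2.

Lemma measurable_rowB_prod : measurable_fun setT rowB.
Proof. exact: measurable_rowB. Qed.

HB.instance Definition _ := @isMeasurableFun.Build _ _ _ _ rowB measurable_rowB_prod.

Variables mu nu : {finite_measure set E -> \bar R}.

Definition diff_measure : set E -> \bar R := pushforward (mu \x nu)%E rowB.

Let diff_measure0 : diff_measure set0 = 0%E.
Proof. exact: measure0. Qed.

Let diff_measure_ge0 B : (0 <= diff_measure B)%E.
Proof. exact: measure_ge0. Qed.

Let diff_measure_sigma_additive : semi_sigma_additive diff_measure.
Proof. exact: measure_semi_sigma_additive. Qed.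

HB.instance Definition _ := isMeasure.Build _ _ _ diff_measure
  diff_measure0 diff_measure_ge0 diff_measure_sigma_additive.


Let diff_measure_fin : fin_num_fun diff_measure.
Proof.
apply: lty_fin_num_fun.
exact: (lty_product_measure mu nu).
Qed.

HB.instance Definition _ := Measure_isFinite.Build _ _ _ diff_measure diff_measure_fin.

End diff_measure.

Section fourier.
Context {R : realType} {d : nat}.
Local Notation E := (borelRd R d).
Local Notation lebd := (@lebesgue_Rd R d).

Let A (z x : E) : R := - (2 * pi * dotprod z x).

Let measurable_A d' (T : measurableType d') (f g : T -> E) :
  measurable_fun setT f -> measurable_fun setT g ->
  measurable_fun setT (fun t => A (f t) (g t)).
Proof.
move=> mf mg; apply: measurable_funN; apply: measurable_funM => //.
exact: measurable_dotprod.
Qed.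

Let AB z x y : A z (x - y) = A z x - A z y.
Proof.
rewrite /A (_ : dotprod z (_ - _) = dotprod z x - dotprod z y); first by ring.
by rewrite /dotprod -sumrB; apply: eq_bigr => i _; rewrite !mxE; ring.
Qed.

Lemma abs_fourierE (mu : {measure set E -> \bar R}) z : abs_fourier mu z =
  Num.sqrt ((\int[mu]_x cos (A z x)) ^+ 2 + (\int[mu]_x sin (A z x)) ^+ 2).
Proof. by []. Qed.

Lemma abs_fourier_ge0 (mu : {measure set E -> \bar R}) z : 0 <= abs_fourier mu z.
Proof. exact: sqrtr_ge0. Qed.

Let sqr_abs_fourier (mu : {measure set E -> \bar R}) z : abs_fourier mu z ^+ 2 =
  (\int[mu]_x cos (A z x)) ^+ 2 + (\int[mu]_x sin (A z x)) ^+ 2.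
Proof. by rewrite abs_fourierE sqr_sqrtr// addr_ge0// sqr_ge0. Qed.

Let integrable_cosA (mu : {finite_measure set E -> \bar R}) z :
  mu.-integrable setT (EFin \o (fun x => cos (A z x))).
Proof.
apply: integrable_le1 => [||x]; last exact: cos_max.
  by rewrite ltey_eq fin_num_measure.
by apply: (measurableT_comp measurable_cos); exact: measurable_A.
Qed.

Let integrable_sinA (mu : {finite_measure set E -> \bar R}) z :
  mu.-integrable setT (EFin \o (fun x => sin (A z x))).
Proof.
apply: integrable_le1 => [||x]; last exact: sin_max.
  by rewrite ltey_eq fin_num_measure.
by apply: (measurableT_comp measurable_sin); exact: measurable_A.
Qed.

Lemma measurable_abs_fourier (mu : {finite_measure set E -> \bar R}) :
  measurable_fun setT (abs_fourier mu : E -> R).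
Proof.
have mA : measurable_fun setT (fun p : E * E => A p.1 p.2) by exact: measurable_A.
apply: (@measurableT_comp _ _ _ _ _ _ (@Num.sqrt R)).
  by apply: continuous_measurable_fun; exact: sqrt_continuous.
apply: measurable_funD; apply: measurable_funX.
  apply: (@measurable_integral_param _ _ _ _ _ mu (fun p => cos (A p.1 p.2)))
    => [|x]; last exact: cos_max.
  exact: (measurableT_comp measurable_cos).
apply: (@measurable_integral_param _ _ _ _ _ mu (fun p => sin (A p.1 p.2)))
  => [|x]; last exact: sin_max.
exact: (measurableT_comp measurable_sin).
Qed.

Section diff_measure.
Variables mu nu : {finite_measure set E -> \bar R}.

Lemma integral_diff_measure (f : E -> R) : measurable_fun setT f ->
  (forall x, `|f x| <= 1) ->
  \int[diff_measure mu nu]_x f x = \int[(mu \x nu)%E]_p f (p.1 - p.2).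
Proof.
move=> mf f1; rewrite /Rintegral; congr fine.
have mf' : measurable_fun setT (EFin \o f) by exact/measurable_EFinP.
have fi : (mu \x nu)%E.-integrable (rowB @^-1` setT) ((EFin \o f) \o rowB).
  rewrite preimage_setT; apply: (@integrable_le1 _ _ _ _ (f \o rowB)).
  - exact: lty_product_measure.
  - exact: measurableT_comp mf measurable_rowB_prod.
  - by move=> x; exact: f1.
by rewrite (integral_pushforward measurable_rowB_prod mf' fi) ?preimage_setT.
Qed.

(** The transform of the difference measure is [mu^] times the conjugate of [nu^]. In real and
    imaginary parts the claim becomes the two-square identity [(ac + bd)^2 + (bc - ad)^2 = (a^2 +
    b^2)(c^2 + d^2)]. *)
Lemma abs_fourier_diff_measure z :
  abs_fourier (diff_measure mu nu) z ^+ 2 = abs_fourier mu z ^+ 2 * abs_fourier nu z ^+ 2.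
Proof.
rewrite !sqr_abs_fourier; set C := fun x => cos (A z x); set S := fun x => sin (A z x).
have CC := integrable_prodM (integrable_cosA mu z) (integrable_cosA nu z).
have SS := integrable_prodM (integrable_sinA mu z) (integrable_sinA nu z).
have SC := integrable_prodM (integrable_sinA mu z) (integrable_cosA nu z).
have CS := integrable_prodM (integrable_cosA mu z) (integrable_sinA nu z).
rewrite (@integral_diff_measure C); last 2 first.
- by apply: (measurableT_comp measurable_cos); exact: measurable_A.
- by move=> x; exact: cos_max.
rewrite (@integral_diff_measure S); last 2 first.
- by apply: (measurableT_comp measurable_sin); exact: measurable_A.
- by move=> x; exact: sin_max.
under eq_Rintegral do rewrite /C AB cosB.
under [X in _ + X ^+ 2]eq_Rintegral do rewrite /S AB sinB.
rewrite RintegralD// RintegralB//.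
rewrite (Rintegral_prodM (integrable_cosA mu z) (integrable_cosA nu z)).
rewrite (Rintegral_prodM (integrable_sinA mu z) (integrable_sinA nu z)).
rewrite (Rintegral_prodM (integrable_sinA mu z) (integrable_cosA nu z)).
rewrite (Rintegral_prodM (integrable_cosA mu z) (integrable_sinA nu z)).
by rewrite -/C -/S; ring.
Qed.

End diff_measure.

Variable s : {finite_measure set E -> \bar R}.

(** As an integral over pairs of points, [|s^(z)|^2] can be integrated in [z] against a kernel under
    the integral sign. *)
Lemma abs_fourier_sqr_prod z : abs_fourier s z ^+ 2 =
  \int[finite_prod s s]_p cos (2 * pi * dotprod z (p.1 - p.2)).
Proof.
rewrite Rintegral_finite_prod sqr_abs_fourier.
have CC := integrable_prodM (integrable_cosA s z) (integrable_cosA s z).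
have SS := integrable_prodM (integrable_sinA s z) (integrable_sinA s z).
transitivity (\int[(s \x s)%E]_p (cos (A z p.1) * cos (A z p.2) + sin (A z p.1) * sin (A z p.2))).
  rewrite RintegralD// !expr2.
  rewrite (Rintegral_prodM (integrable_cosA s z) (integrable_cosA s z)).
  by rewrite (Rintegral_prodM (integrable_sinA s z) (integrable_sinA s z)).
by apply: eq_Rintegral => p _; rewrite -cosB -AB /A cosN.
Qed.

(* The constant is a lower bound on [-r, r] for the Fourier transform
   2 r / (r^2 + (2 pi t)^2) of e^(-r |x|). *)
Lemma correlation_le_fourier (r : R) : 0 < r ->
  (((2 / (r * (1 + (2 * pi) ^+ 2))) ^+ d)%:E *
     finite_prod s s [set p : E * E | forall i, (`|(p.1 - p.2) ord0 i| <= r)%R] <=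
   \int[lebd]_z (expRn r z * abs_fourier s z ^+ 2)%:E)%E.
Proof.
pose P := finite_prod s s; move=> r0; set D := [set p | _]; set c := _ ^+ d.
have pi2 : 0 < 1 + (2 * pi) ^+ 2 :> R by rewrite ltr_pwDl// sqr_ge0.
have c0 : 0 <= c by rewrite exprn_ge0// divr_ge0// mulr_ge0// ltW.
have mD : measurable D.
  rewrite -[D]setTI; apply: (measurable_rowB_prod _ (measurable_row_normr_le r)) => //.
pose G (w : E * (E * E)) : R := expRn r w.1 * cos (2 * pi * dotprod w.1 (w.2.1 - w.2.2)).
have mcos : measurable_fun setT (fun w : E * (E * E) => cos (2 * pi * dotprod w.1 (w.2.1 - w.2.2))).
  apply: (measurableT_comp measurable_cos); apply: measurable_funM => //.
  apply: measurable_dotprod => //.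
  by apply: measurable_rowB; exact: measurableT_comp.
have mG : measurable_fun setT G.
  by apply: measurable_funM => //; apply: measurableT_comp => //; exact: measurable_expRn.
have I1 : P.-integrable setT (EFin \o cst 1).
  by apply: integrable_le1 => // [|x]; rewrite ?normr1// ltey_eq fin_num_measure.
have I : (lebd \x P)%E.-integrable setT (EFin \o G).
  apply: le_integrable (integrable_prodM (integrable_expRn r0) I1) => //.
    exact/measurable_EFinP.
  by move=> w _; rewrite lee_fin /= mulr1 normrM ler_piMr// cos_max.
have -> : (\int[lebd]_z (expRn r z * abs_fourier s z ^+ 2)%:E =
    \int[lebd]_z fubini_F P (EFin \o G) z)%E.
  apply: eq_integral => z _; rewrite abs_fourier_sqr_prod EFinM /Rintegral.
  pose g (p : E * E) : R := cos (2 * pi * dotprod z (p.1 - p.2)).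
  have ic : P.-integrable setT (EFin \o g).
    apply: integrable_le1 => [||x]; last exact: cos_max.
      by rewrite ltey_eq fin_num_measure.
    exact: (measurableT_comp mcos (pair1_measurable z)).
  rewrite fineK ?integrable_fin_num// -integralZl//.
rewrite (integral12_prod_meas1 I) -(integral21_prod_meas1 I).
(* Integrating [z] out first leaves a product of Cauchy kernels in the coordinates of the
   difference. It is nonnegative, so the pairs outside [D] may be dropped. *)
have GE p : fubini_G lebd (EFin \o G) p =
    (\prod_i (2 * r / (r ^+ 2 + (2 * pi * (p.1 - p.2) ord0 i) ^+ 2)))%:E.
  rewrite -Rintegral_expRn_cos// /Rintegral fineK//; apply: integrable_fin_num => //.
  apply: le_integrable (integrable_expRn r0) => //.
    apply/measurable_EFinP; exact: (measurableT_comp mG (pair2_measurable p)).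
  by move=> z _; rewrite lee_fin /= normrM ler_piMr// cos_max.
have -> : finite_prod s s D = (\int[P]_p (\1_D p)%:E)%E.
  by rewrite integral_indic// setIT.
rewrite -ge0_integralZl//; last by apply/measurable_EFinP; exact: measurable_indic.
apply: ge0_le_integral => //.
- by move=> p _; rewrite mule_ge0// lee_fin.
- by apply/measurable_EFinP; apply: measurable_funM => //; exact: measurable_indic.
- exact: measurable_fubini_G I.
move=> p _; rewrite GE -EFinM lee_fin indicE.
case: (boolP (p \in D)) => [|_]; last first.
  rewrite mulr0 prodr_ge0// => i _.
  by rewrite divr_ge0 ?(mulr_ge0 _ (ltW r0))// addr_ge0 ?sqr_ge0.
rewrite inE mulr1 /c => pD; rewrite -[X in _ ^+ X]card_ord -prodr_const.
have den0 (y : R) : 0 < r ^+ 2 + y ^+ 2 by rewrite ltr_wpDr ?sqr_ge0// exprn_gt0.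
apply: ler_prod => i _; apply/andP; split.
  by rewrite divr_ge0// mulr_ge0 ?(ltW r0) ?(ltW pi2).
have -> : 2 / (r * (1 + (2 * pi) ^+ 2)) = 2 * r / (r ^+ 2 + (2 * pi * r) ^+ 2) :> R.
  by field; rewrite ?gt_eqF//= -?exprMn ?den0 //; nra.
rewrite ler_pM2l ?mulr_gt0// lef_pV2 ?posrE// lerD2l !exprMn ler_wpM2l//.
  by rewrite mulr_ge0// sqr_ge0.
rewrite -[X in X <= _]real_normK ?num_real// lerXn2r ?nnegrE ?(ltW r0)//.
exact: pD.
Qed.

End fourier.

(** * Near-diagonal mass and integrability at infinity *)

Section enorm.
Context {R : realType} {d : nat}.
Implicit Types z : 'rV[R]_d.

Lemma dotprod_ge0 z : 0 <= dotprod z z.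
Proof. by apply: sumr_ge0 => i _; rewrite -expr2 sqr_ge0. Qed.

Lemma enorm_ge0 z : 0 <= enorm z.
Proof. exact: sqrtr_ge0. Qed.

Lemma sqr_enorm z : enorm z ^+ 2 = \sum_i z ord0 i ^+ 2.
Proof. by rewrite sqr_sqrtr ?dotprod_ge0//; apply: eq_bigr => i _; rewrite expr2. Qed.

Lemma normr_le_enorm z i : `|z ord0 i| <= enorm z.
Proof.
rewrite -(@ler_pXn2r _ 2) ?nnegrE ?enorm_ge0// sqr_enorm real_normK ?num_real//.
by rewrite (bigD1 i)//= lerDl sumr_ge0// => j _; rewrite sqr_ge0.
Qed.

Lemma enorm_le_sum z : enorm z <= \sum_i `|z ord0 i|.
Proof.
have S0 : 0 <= \sum_i `|z ord0 i| by exact: sumr_ge0.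
rewrite -(@ler_pXn2r _ 2) ?nnegrE ?enorm_ge0// sqr_enorm expr2 mulr_suml.
apply: ler_sum => i _; rewrite -real_normK ?num_real// expr2 ler_wpM2l//.
by rewrite (bigD1 i)//= lerDl sumr_ge0.
Qed.

End enorm.

(** For [v = r |z|] this trades the exponential weight for a power: [e^(-r |z|) <= r^(-p) |z|^(-p)].
    For [p] in [[0, 1]] both sides compare with [max(1, v)]. *)
Lemma powR_le_expR (R : realType) (v p : R) : 0 < v -> 0 <= p <= 1 -> v `^ p <= expR v.
Proof.
move=> v0 /andP[p0 p1]; have [v1|v1] := leP v 1.
  rewrite (@le_trans _ _ 1)//; last by rewrite -expR0 ler_expR ltW.
  by rewrite -(powRr0 v) ger_powR// v0.
rewrite (@le_trans _ _ v)//; last by rewrite (le_trans _ (expR_ge1Dx v))// lerDr.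
by rewrite -[leRHS](powRr1 (ltW v0)) ler_powR// ltW.
Qed.

Section energy.
Context {R : realType} {d : nat}.
Local Notation E := (borelRd R d).
Local Notation lebd := (@lebesgue_Rd R d).

Lemma measurable_enorm_id : measurable_fun setT (fun z : E => enorm z).
Proof. by apply: measurable_enorm; exact: measurable_id. Qed.

Lemma measurable_enorm_ge1 : measurable [set z : E | 1 <= enorm z].
Proof.
rewrite (_ : mkset _ = (fun z : E => enorm z) @^-1` `[1, +oo[); last first.
  by apply/seteqP; split => z /=; rewrite in_itv/= andbT.
by rewrite -[X in measurable X]setTI; exact: measurable_enorm_id.
Qed.

Lemma expRnE (a : R) (z : E) : expRn a z = expR (- (a * \sum_i `|z ord0 i|)).
Proof. by rewrite /expRn mulr_sumr -sumrN expR_sum. Qed.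

(** Bounding the cosine by 1 gives the only control used near the origin, and at infinity when the
    exponent is negative. *)
Lemma sqr_abs_fourier_le (s : {finite_measure set E -> \bar R}) z :
  abs_fourier s z ^+ 2 <= fine (finite_prod s s setT).
Proof.
pose g (p : E * E) : R := cos (2 * pi * dotprod z (p.1 - p.2)).
have P0 : (finite_prod s s setT < +oo)%E by rewrite ltey_eq fin_num_measure.
have mg : measurable_fun setT g.
  apply: (measurableT_comp measurable_cos); apply: measurable_funM => //.
  by apply: measurable_dotprod => //; exact: measurable_rowB.
have gi : (finite_prod s s).-integrable setT (EFin \o g).
  by apply: integrable_le1 => // x; exact: cos_max.
have ci : (finite_prod s s).-integrable setT (EFin \o cst 1).
  by apply: integrable_le1 => // x; rewrite normr1.
rewrite abs_fourier_sqr_prod.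
apply: (@le_trans _ _ (\int[finite_prod s s]_p (cst 1 p))).
  by apply: le_Rintegral => // p _; exact: cos_le1.
by rewrite Rintegral_cst// mul1r.
Qed.

Variables (s : {finite_measure set E -> \bar R}) (p : R).
Hypothesis p01 : 0 <= p <= 1.
Hypothesis Ioo : (\int[lebd]_(z in [set z | (1 <= enorm z)%R])
  (abs_fourier s z ^+ 2 * enorm z `^ (- p))%:E < +oo)%E.

Let m2 : measurable_fun setT (fun z : E => abs_fourier s z ^+ 2).
Proof. by apply: measurable_funX; exact: measurable_abs_fourier. Qed.

Let mp (q : R) : measurable_fun setT (fun z : E => enorm z `^ q).
Proof.
by apply: (@measurableT_comp _ _ _ _ _ _ (fun x : R => x `^ q)) => //;
  exact: measurable_enorm_id.
Qed.

(** The integral is split at [|z| = 1]. Outside, [|z| <= |z|_1] and [powR_le_expR] reduce it to the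
    hypothesis [Ioo]. Inside, the transform is bounded by the total mass, and the factor
    [r^(-p) >= 1] is simply added. *)
Let expRn_sqr_le : exists2 C : R, 0 <= C & forall r, 0 < r <= 1 ->
  (\int[lebd]_z (expRn r z * abs_fourier s z ^+ 2)%:E <= (C * r `^ (- p))%:E)%E.
Proof.
move: Ioo; set D : set E := [set z | _]; set I := (X in (X < _)%E) => Ioo2.
have mD : measurable D by exact: measurable_enorm_ge1.
have I0 : (0 <= I)%E.
  by apply: integral_ge0 => z _; rewrite lee_fin mulr_ge0 ?sqr_ge0 ?powR_ge0.
have P0 : 0 <= fine (finite_prod s s setT) by rewrite fine_ge0.
(* On the unit ball [|z|_1 <= d], hence [e^d e^(-|z|_1) >= 1]: an integrable majorant of the
   indicator of the ball, which avoids computing a volume. *)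
pose M := fine (finite_prod s s setT) * expR d%:R.
have M0 : 0 <= M by rewrite mulr_ge0 ?expR_ge0.
have J := integrable_expRn (d := d) (@ltr01 R).
have J0 : 0 <= \int[lebd]_z expRn 1 z by apply: Rintegral_ge0 => z _; exact: expRn_ge0.
exists (M * \int[lebd]_z expRn 1 z + fine I).
  by rewrite addr_ge0 ?mulr_ge0// fine_ge0.
move=> r /andP[r0 r1].
have rp1 : 1 <= r `^ (- p).
  by rewrite -(powRr0 r) ger_powR ?r0// oppr_le0; case/andP: p01.
have rp0 : 0 <= r `^ (- p) by exact: powR_ge0.
pose g1 (z : E) := (r `^ (- p) * (M * expRn 1 z))%:E.
pose g2 (z : E) := ((r `^ (- p))%:E * (abs_fourier s z ^+ 2 * enorm z `^ (- p) * \1_D z)%:E)%E.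
have mg1 : measurable_fun setT g1.
  apply/measurable_EFinP; apply: measurable_funM => //; apply: measurable_funM => //.
  exact: measurable_expRn.
have mg2' : measurable_fun setT (fun z : E =>
    ((abs_fourier s z ^+ 2 * enorm z `^ (- p)) * \1_D z)%:E).
  apply/measurable_EFinP; apply: measurable_funM; last exact: measurable_indic.
  by apply: measurable_funM.
have g20 z : (0 <= (abs_fourier s z ^+ 2 * enorm z `^ (- p) * \1_D z)%:E)%E.
  by rewrite lee_fin mulr_ge0// mulr_ge0 ?sqr_ge0 ?powR_ge0.
have mg2 : measurable_fun setT g2.
  exact: measurable_funeM mg2'.
apply: (@le_trans _ _ (\int[lebd]_z (g1 z + g2 z))%E).
  apply: ge0_le_integral => //.
  - by move=> z _; rewrite lee_fin mulr_ge0 ?sqr_ge0 ?expRn_ge0.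
  - by apply/measurable_EFinP; apply: measurable_funM => //; exact: measurable_expRn.
  - exact: emeasurable_funD.
  move=> z _; rewrite /g1 /g2 -!EFinM -EFinD lee_fin indicE.
  have [zD|zD] := boolP (z \in D).
    rewrite mulr1 (@le_trans _ _ (r `^ (- p) * (abs_fourier s z ^+ 2 * enorm z `^ (- p))))//.
      rewrite mulrC mulrCA ler_wpM2l ?sqr_ge0//.
      have z0 : 0 < enorm z by rewrite (lt_le_trans ltr01)//; rewrite inE in zD.
      rewrite -powRM ?(ltW r0) ?(ltW z0)// powRN expRnE expRN.
      rewrite lef_pV2 ?posrE ?expR_gt0 ?powR_gt0 ?mulr_gt0//.
      rewrite (le_trans (powR_le_expR _ p01)) ?mulr_gt0// ler_expR ler_pM2l//.
      exact: enorm_le_sum.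
    by rewrite lerDr mulr_ge0// mulr_ge0 ?expRn_ge0.
  rewrite !mulr0 addr0 (@le_trans _ _ (M * expRn 1 z))//; last first.
    by rewrite ler_peMl// mulr_ge0// expRn_ge0.
  have z1 : enorm z <= 1 by rewrite ltW// ltNge; move: zD; rewrite notin_setE => /negP.
  have er1 : expRn r z <= 1.
    by rewrite expRnE -expR0 ler_expR oppr_le0 mulr_ge0 ?(ltW r0)// sumr_ge0.
  have e1 : 1 <= expR d%:R * expRn 1 z.
    rewrite expRnE mul1r -expRD -[leLHS]expR0 ler_expR subr_ge0.
    rewrite (@le_trans _ _ (\sum_(i < d) 1))//; last by rewrite sumr_const card_ord.
    apply: ler_sum => i _.
    exact: le_trans (normr_le_enorm z i) z1.
  rewrite (@le_trans _ _ (fine (finite_prod s s setT)))//.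
    by rewrite -[leRHS]mul1r ler_pM ?expRn_ge0 ?sqr_ge0// sqr_abs_fourier_le.
  by rewrite /M -mulrA ler_peMr.
rewrite ge0_integralD//; last 2 first.
- by move=> z _; rewrite lee_fin mulr_ge0// mulr_ge0 ?expRn_ge0.
- by move=> z _; apply: mule_ge0; [rewrite lee_fin|exact: g20].
rewrite mulrDl EFinD; apply: leeD.
  rewrite /g1; under eq_integral do rewrite EFinM EFinM.
  rewrite ge0_integralZl ?lee_fin//; last 2 first.
  - by apply/measurable_EFinP; apply: measurable_funM => //; exact: measurable_expRn.
  - by move=> z _; rewrite mule_ge0 ?lee_fin ?expRn_ge0.
  rewrite integralZl//= -(fineK (integrable_fin_num _ J))// -!EFinM lee_fin.
  by rewrite mulrC.
rewrite /g2.
rewrite ge0_integralZl ?lee_fin// EFinM muleC fineK ?ge0_fin_numE//.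
rewrite lee_wpmul2r ?lee_fin// /I.
rewrite [leRHS]integral_mkcond le_eqVlt; apply/orP; left; apply/eqP.
by apply: eq_integral => z _; rewrite patchE indicE; case: ifP; rewrite ?mulr1 ?mulr0.
Qed.

Lemma correlation_le : exists2 C : R, 0 <= C & forall r, 0 < r <= 1 ->
  (finite_prod s s [set q : E * E | forall i, (`|(q.1 - q.2) ord0 i| <= r)%R] <=
   (C * r `^ (d%:R - p))%:E)%E.
Proof.
have [C C0 HC] := expRn_sqr_le.
(* [(r k)^-1] is the lower bound per coordinate in [correlation_le_fourier]; its [d]-th power, moved
   to the other side, supplies the factor [r^d]. *)
pose k : R := (1 + (2 * pi) ^+ 2) / 2.
have k0 : 0 < k by rewrite divr_gt0// ltr_pwDl// sqr_ge0.
exists (C * k ^+ d); first by rewrite mulr_ge0// exprn_ge0// ltW.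
move=> r r01; have /andP[r0 _] := r01.
have := le_trans (correlation_le_fourier s r0) (HC r r01).
have -> : 2 / (r * (1 + (2 * pi) ^+ 2)) = (r * k)^-1 :> R.
  rewrite /k; set q := 1 + _ in k0 *; have q0 : q != 0 by rewrite gt_eqF// /q ltr_pwDl// sqr_ge0.
  by field; rewrite q0 gt_eqF.
rewrite exprVn lee_pdivrMl ?(exprn_gt0 _ (mulr_gt0 r0 k0))// -EFinM => H.
apply: (le_trans H); rewrite lee_fin exprMn addrC powRD ?(gt_eqF r0) ?implybT//.
rewrite powR_mulrn ?(ltW r0)// le_eqVlt; apply/orP; left; apply/eqP; ring.
Qed.

End energy.

Section tail.
Context {R : realType} {d : nat}.
Local Notation E := (borelRd R d).
Local Notation lebd := (@lebesgue_Rd R d).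
Local Notation far := [set z : E | (1 <= enorm z)%R].

Lemma measurable_enorm_powR (q : R) : measurable_fun setT (fun z : E => enorm z `^ q).
Proof.
apply: (@measurableT_comp _ _ _ _ _ _ (fun x : R => x `^ q)) => //.
exact: measurable_enorm_id.
Qed.

(** Polar coordinates are avoided: for [|z| >= 1] each [1 + |z_i|] is at most [2 |z|], so the power
    is dominated by a product of one-dimensional integrable weights. The choice [a = e / d] makes
    the [d] exponents [1 + a] add up to [d + e]. *)
Lemma integral_enorm_powR_lty (e : R) : (0 < d)%N -> 0 < e ->
  (\int[lebd]_(z in far) (enorm z `^ (- (d%:R + e)))%:E < +oo)%E.
Proof.
move=> d0 e0; have dR : 0 < d%:R :> R by rewrite ltr0n.
pose a : R := e / d%:R; have a0 : 0 < a by rewrite divr_gt0.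
pose f (x : R) : R := (1 + `|x|) `^ (- (1 + a)).
have mf : measurable_fun setT f.
  apply: (@measurableT_comp _ _ _ _ _ _ (fun x : R => x `^ (- (1 + a)))) => //.
  by apply: measurable_funD => //; exact: measurable_cst.
have fi : (@lebesgue_measure R).-integrable setT (EFin \o f).
  apply/integrableP; split; first exact/measurable_EFinP.
  under eq_integral do rewrite /= ger0_norm ?powR_ge0//.
  exact: integral_powR_norm_lty.
have := integrable_row_prod (d := d) fi.
pose K : R := 2 `^ (d%:R + e).
have K0 : 0 <= K by exact: powR_ge0.
move=> /(integrableZl measurableT K) /integrableP[mg].
apply: le_lt_trans.
rewrite [leLHS]integral_mkcond; apply: ge0_le_integral => //.
- by move=> z _; rewrite patchE; case: ifP => //; rewrite lee_fin powR_ge0.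
- apply/measurable_restrict => //; first exact: measurable_enorm_ge1.
  by rewrite setTI; apply/measurable_EFinP/measurable_funTS; exact: measurable_enorm_powR.
- exact: measurableT_comp.
move=> z _; rewrite patchE; case: ifPn => [|_]; last exact: abse_ge0.
rewrite inE /= => z1; have z0 : 0 < enorm z by rewrite (lt_le_trans ltr01).
rewrite lee_fin ger0_norm; last first.
  by rewrite mulr_ge0// prodr_ge0// => i _; exact: powR_ge0.
have -> : enorm z `^ (- (d%:R + e)) = K * \prod_(i < d) (2 * enorm z) `^ (- (1 + a)).
  rewrite prodr_const card_ord -powR_mulrn ?powR_ge0// -powRrM.
  have -> : - (1 + a) * d%:R = - (d%:R + e) by rewrite /a; field; rewrite gt_eqF.
  rewrite powRM ?(ltW z0)// mulrA /K -powRD ?pnatr_eq0 ?implybT//.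
  by rewrite subrr powRr0 mul1r.
rewrite ler_wpM2l// ler_prod// => i _; rewrite powR_ge0/=.
have f0 : 0 < 1 + `|z ord0 i| by rewrite ltr_pwDl.
have t0 : 0 < 2 * enorm z by rewrite mulr_gt0.
rewrite /f !powRN lef_pV2 ?posrE ?powR_gt0// ge0_ler_powR ?nnegrE ?(ltW f0) ?(ltW t0)//.
  by rewrite addr_ge0// ltW.
by have := normr_le_enorm z i; lra.
Qed.

End tail.

(** * Fourier energies away from the origin *)

Section spectrum.
Context {R : realType} {d : nat}.
Local Notation E := (borelRd R d).
Local Notation lebd := (@lebesgue_Rd R d).
Local Notation far := [set z : E | (1 <= enorm z)%R].

(* Restricting the energy to |z| >= 1 makes it monotone in s, and allows s < 0,
   for which it is always finite. *)
Definition tail_finite (mu : {measure set E -> \bar R}) (theta s : R) : Prop :=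
  if theta == 0 then
    exists C, forall z : E, 1 <= enorm z -> abs_fourier mu z ^+ 2 * enorm z `^ s <= C
  else
    (\int[lebd]_(z in far)
      (abs_fourier mu z `^ (2 / theta) * enorm z `^ (s / theta - d%:R))%:E < +oo)%E.

Implicit Types mu nu : {finite_measure set E -> \bar R}.

Let measurable_integrand mu (a b : R) (A : set E) :
  measurable_fun A (fun z => (abs_fourier mu z `^ a * enorm z `^ b)%:E).
Proof.
apply/measurable_EFinP/measurable_funTS; apply: measurable_funM; last exact: measurable_enorm_powR.
apply: (@measurableT_comp _ _ _ _ _ _ (fun x : R => x `^ a)) => //.
exact: measurable_abs_fourier.
Qed.

Let le_integral_far (f g : E -> R) : measurable_fun setT f -> measurable_fun setT g ->
  (forall z, 0 <= f z) -> (forall z, 1 <= enorm z -> f z <= g z) ->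
  (\int[lebd]_(z in far) (g z)%:E < +oo -> \int[lebd]_(z in far) (f z)%:E < +oo)%E.
Proof.
move=> mf mg f0 fg; apply: le_lt_trans; apply: ge0_le_integral => //.
- exact: measurable_enorm_ge1.
- by move=> z _; rewrite lee_fin.
- by apply/measurable_EFinP/measurable_funTS.
- by apply/measurable_EFinP/measurable_funTS.
Qed.

Let measurable_absX mu (a b : R) :
  measurable_fun setT (fun z : E => abs_fourier mu z `^ a * enorm z `^ b).
Proof. by apply/measurable_EFinP; exact: measurable_integrand. Qed.

Let powR_2div (x theta : R) : 0 <= x -> 0 < theta -> x `^ (2 / theta) = (x ^+ 2) `^ theta^-1.
Proof. by move=> x0 t0; rewrite powRrM powR_mulrn. Qed.

(** Negative [a] cannot be ignored: the spectrum of a measure may be 0, and then every [a] strictly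
    below it is negative. In that case [|z|^(a/theta - d)] is integrable at infinity and the mass
    bound suffices; otherwise a finite energy at some [s >= a] dominates. *)
Lemma lt_spectrum_tail_finite mu (theta a : R) : (0 < d)%N -> 0 <= theta <= 1 ->
  (a%:E < fourier_spectrum_measure mu theta)%E -> tail_finite mu theta a.
Proof.
move=> d0 /andP[t0 t1]; rewrite /fourier_spectrum_measure lt_max => /orP[|].
  rewrite lte_fin => a0; pose M := fine (finite_prod mu mu setT).
  have M0 : 0 <= M by rewrite fine_ge0.
  rewrite /tail_finite; case: ifPn => [_|tN0].
    exists M => z z1; rewrite -[leRHS]mulr1 ler_pM ?sqr_ge0 ?powR_ge0//.
      exact: sqr_abs_fourier_le.
    by rewrite -(powRr0 (enorm z)) ler_powR// ltW.
  have {}t0 : 0 < theta by rewrite lt_neqAle eq_sym tN0.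
  pose e := - (a / theta).
  have e0 : 0 < e by rewrite oppr_gt0 pmulr_llt0// invr_gt0.
  apply: (@le_integral_far _ (fun z => M `^ theta^-1 * enorm z `^ (- (d%:R + e)))).
  - exact: measurable_absX.
  - by apply: measurable_funM => //; exact: measurable_enorm_powR.
  - by move=> z; rewrite mulr_ge0 ?powR_ge0.
  - move=> z z1; rewrite (_ : - (d%:R + e) = a / theta - d%:R); last by rewrite /e; ring.
    rewrite ler_wpM2r ?powR_ge0// powR_2div ?abs_fourier_ge0//.
    by rewrite ge0_ler_powR ?nnegrE ?invr_ge0 ?(ltW t0) ?sqr_ge0 ?sqr_abs_fourier_le.
  under eq_integral do rewrite EFinM.
  rewrite ge0_integralZl ?lee_fin ?powR_ge0//; last 3 first.
  - exact: measurable_enorm_ge1.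
  - by apply/measurable_EFinP/measurable_funTS; exact: measurable_enorm_powR.
  - by move=> z _; rewrite lee_fin powR_ge0.
  by rewrite lte_mul_pinfty ?lee_fin ?powR_ge0//; exact: integral_enorm_powR_lty.
move=> /ereal_sup_gt[_ [s [s0 soo] <-]]; rewrite lte_fin => /ltW as_.
move: soo; rewrite /fourier_energy /tail_finite; case: ifPn => [_ soo|tN0].
  exists (fine (ereal_sup [set (abs_fourier mu z ^+ 2 * enorm z `^ s)%:E | z in setT])) => z z1.
  have ub : ((abs_fourier mu z ^+ 2 * enorm z `^ s)%:E <=
      ereal_sup [set (abs_fourier mu z ^+ 2 * enorm z `^ s)%:E | z in setT])%E.
    by apply: ereal_sup_ubound; exists z.
  rewrite (@le_trans _ _ (abs_fourier mu z ^+ 2 * enorm z `^ s))//.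
    by rewrite ler_wpM2l ?sqr_ge0// ler_powR.
  rewrite -lee_fin fineK// fin_numElt soo andbT (lt_le_trans _ ub)// ltNyr//.
have {}t0 : 0 < theta by rewrite lt_neqAle eq_sym tN0.
move=> /(lty_poweRy tN0) soo.
apply: (@le_integral_far _ (fun z =>
  abs_fourier mu z `^ (2 / theta) * enorm z `^ (s / theta - d%:R))).
- exact: measurable_absX.
- exact: measurable_absX.
- by move=> z; rewrite mulr_ge0 ?powR_ge0.
- by move=> z z1; rewrite ler_wpM2l ?powR_ge0// ler_powR// lerD2r ler_pM2r ?invr_gt0.
apply: le_lt_trans soo; apply: ge0_subset_integral => //.
- exact: measurable_enorm_ge1.
- by move=> z _; rewrite lee_fin mulr_ge0 ?powR_ge0.
Qed.

(** Endpoint case: the energy at 0 is a supremum, so the bound on [|mu^|^2 |z|^a] is pulled out of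
    the integral, and what remains is the energy of [nu] at 1. *)
Let tail_mul0 mu nu (a b q : R) : q <= a + b - d%:R ->
  tail_finite mu 0 a -> tail_finite nu 1 b ->
  (\int[lebd]_(z in far)
     (abs_fourier mu z ^+ 2 * abs_fourier nu z ^+ 2 * enorm z `^ q)%:E < +oo)%E.
Proof.
rewrite /tail_finite eqxx oner_eq0 => qab [C HC] H.
pose C' := Num.max C 0; have C0 : 0 <= C' by rewrite le_max lexx orbT.
apply: (@le_integral_far _ (fun z =>
  C' * (abs_fourier nu z `^ (2 / 1) * enorm z `^ (b / 1 - d%:R)))).
- apply: measurable_funM; last exact: measurable_enorm_powR.
  by apply: measurable_funM; apply: measurable_funX; exact: measurable_abs_fourier.
- by apply: measurable_funM => //; exact: measurable_absX.
- by move=> z; rewrite mulr_ge0 ?powR_ge0// mulr_ge0 ?sqr_ge0.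
- move=> z z1; have z0 : 0 < enorm z by rewrite (lt_le_trans ltr01).
  rewrite !divr1 powR_mulrn ?abs_fourier_ge0//.
  apply: (@le_trans _ _ ((abs_fourier mu z ^+ 2 * enorm z `^ a) *
      (abs_fourier nu z ^+ 2 * enorm z `^ (b - d%:R)))).
    rewrite [leRHS]mulrACA -powRD ?(gt_eqF z0) ?implybT//.
    by apply: ler_wpM2l; [apply: mulr_ge0; exact: sqr_ge0|rewrite ler_powR// addrA].
  apply: ler_wpM2r; first by rewrite mulr_ge0 ?sqr_ge0 ?powR_ge0.
  by rewrite (le_trans (HC z z1))// le_max lexx.
under eq_integral do rewrite EFinM.
rewrite ge0_integralZl ?lee_fin//; last 2 first.
- exact: measurable_enorm_ge1.
- by move=> z _; rewrite lee_fin mulr_ge0 ?powR_ge0.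
by rewrite lte_mul_pinfty ?lee_fin.
Qed.

(** Raising the two energy integrands to the powers [theta] and [1 - theta] gives
    [|mu^|^2 |z|^(a - d theta)] and [|nu^|^2 |z|^(b - d (1 - theta))]. Since the exponents [theta]
    and [1 - theta] add up to 1, their product carries exactly [|z|^(a + b - d)]; this is why
    complementary exponents are paired. *)
Lemma tail_finite_mul mu nu (theta a b q : R) : 0 <= theta <= 1 ->
  q <= a + b - d%:R -> tail_finite mu theta a -> tail_finite nu (1 - theta) b ->
  (\int[lebd]_(z in far)
     (abs_fourier mu z ^+ 2 * abs_fourier nu z ^+ 2 * enorm z `^ q)%:E < +oo)%E.
Proof.
move=> /andP[t0 t1] qab; have [->|tN0] := eqVneq theta 0.
  by rewrite subr0; exact: tail_mul0.
have [->|tN1] := eqVneq theta 1.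
  rewrite subrr => H1 H0; under eq_integral do rewrite (mulrC (abs_fourier mu _ ^+ 2)).
  by apply: tail_mul0 H0 H1; rewrite (addrC b).
have {tN0}t0 : 0 < theta by rewrite lt_neqAle eq_sym tN0.
have {tN1}t1 : 0 < 1 - theta by rewrite subr_gt0 lt_neqAle tN1.
rewrite /tail_finite (gt_eqF t0) (gt_eqF t1).
set F := (X in (\int[_]_(z in _) X z < _)%E -> _) => HF.
set G := (X in (\int[_]_(z in _) X z < _)%E -> _) => HG.
apply: (@le_integral_far _ (fun z =>
   abs_fourier mu z `^ (2 / theta) * enorm z `^ (a / theta - d%:R) +
   abs_fourier nu z `^ (2 / (1 - theta)) * enorm z `^ (b / (1 - theta) - d%:R))).
- apply: measurable_funM; last exact: measurable_enorm_powR.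
  by apply: measurable_funM; apply: measurable_funX; exact: measurable_abs_fourier.
- by apply: measurable_funD; exact: measurable_absX.
- by move=> z; rewrite mulr_ge0 ?powR_ge0// mulr_ge0 ?sqr_ge0.
- move=> z z1; have z0 : 0 < enorm z by rewrite (lt_le_trans ltr01).
  set x := (X in _ <= X + _); set y := (X in _ <= _ + X).
  have x0 : 0 <= x by rewrite mulr_ge0 ?powR_ge0.
  have y0 : 0 <= y by rewrite mulr_ge0 ?powR_ge0.
  have xE : x `^ theta = abs_fourier mu z ^+ 2 * enorm z `^ (a - d%:R * theta).
    rewrite powRM ?powR_ge0// -!powRrM divfK ?gt_eqF// powR_mulrn ?abs_fourier_ge0//.
    by rewrite mulrBl divfK ?gt_eqF.
  have yE : y `^ (1 - theta) = abs_fourier nu z ^+ 2 * enorm z `^ (b - d%:R * (1 - theta)).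
    rewrite powRM ?powR_ge0// -!powRrM divfK ?gt_eqF// powR_mulrn ?abs_fourier_ge0//.
    by rewrite mulrBl divfK ?gt_eqF.
  apply: (@le_trans _ _ (x `^ theta * y `^ (1 - theta))).
    rewrite xE yE [leRHS]mulrACA -powRD ?(gt_eqF z0) ?implybT//.
    apply: ler_wpM2l; first by apply: mulr_ge0; exact: sqr_ge0.
    rewrite ler_powR// (le_trans qab)//.
    by rewrite le_eqVlt; apply/orP; left; apply/eqP; ring.
  have xy0 : 0 <= x + y by rewrite addr_ge0.
  apply: (@le_trans _ _ ((x + y) `^ theta * (x + y) `^ (1 - theta))).
    by rewrite ler_pM ?powR_ge0// ge0_ler_powR ?nnegrE ?(ltW t0) ?(ltW t1)// ?lerDl ?lerDr.
  have e1 : theta + (1 - theta) = 1 by ring.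
  by rewrite -powRD e1 ?oner_eq0// powRr1.
under eq_integral do rewrite EFinD.
rewrite ge0_integralD//=; first by rewrite lte_add_pinfty.
- exact: measurable_enorm_ge1.
- by move=> z _; rewrite lee_fin mulr_ge0 ?powR_ge0.
- by move=> z _; rewrite lee_fin mulr_ge0 ?powR_ge0.
Qed.

End spectrum.

(** * Cells of the radial projection *)

Lemma sqr_sum_le (R : realFieldType) (I : finType) (A : {pred I}) (f : I -> R) :
  (\sum_(i in A) f i) ^+ 2 <= #|A|%:R * \sum_(i in A) f i ^+ 2.
Proof.
rewrite expr2 mulr_suml.
under eq_bigr do rewrite mulr_sumr.
apply: (@le_trans _ _ (\sum_(i in A) \sum_(j in A) (f i ^+ 2 / 2 + f j ^+ 2 / 2))).
  by apply: ler_sum => i _; apply: ler_sum => j _; have := sqr_ge0 (f i - f j); nra.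
under eq_bigr do rewrite big_split/= sumr_const.
rewrite big_split/= sumrMnl sumr_const -mulr_suml -mulrnDl -splitr.
by rewrite mulr_natl.
Qed.

Section finite_families.
Context d (T : measurableType d) (R : realType) (m : {finite_measure set T -> \bar R}).
Variable I : finType.
Implicit Types F : I -> set T.

Lemma fine_measure_le_sum F (A : set T) : (forall i, measurable (F i)) ->
  measurable A -> A `<=` \bigcup_i F i -> fine (m A) <= \sum_i fine (m (F i)).
Proof.
move=> mF mA AF; pose F' k := if insub k is Some j then F (enum_val (j : 'I_#|I|)) else set0.
have mF' k : measurable (F' k) by rewrite /F'; case: insub.
have H : (m A <= \sum_(k < #|I|) m (F' k))%E.
  apply: content_subadditive => //; rewrite -bigcup_mkord => x /AF[i _ Fi].
  by exists (enum_rank i) => /=; [exact: ltn_ord|rewrite /F' valK enum_rankK].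
rewrite (reindex (fun j : 'I_#|I| => enum_val j))/=; last first.
  exact: onW_bij (enum_val_bij _).
rewrite -lee_fin fineK ?fin_num_measure// -sumEFin (le_trans H)//.
apply: lee_sum => j _; rewrite /F' valK fineK ?fin_num_measure//.
Qed.

Lemma sum_fine_measure_le F (A : set T) : (forall i, measurable (F i)) ->
  measurable A -> (forall i, F i `<=` A) -> trivIset setT F ->
  \sum_i fine (m (F i)) <= fine (m A).
Proof.
move=> mF mA FA tF; pose F' (j : 'I_#|I|) := F (enum_val j).
have tF' : trivIset setT F'.
  move=> i j _ _ [x [Fi Fj]]; apply: enum_val_inj.
  by apply: tF => //; exists x.
rewrite (reindex (fun j : 'I_#|I| => enum_val j))/=; last first.
  exact: onW_bij (enum_val_bij _).
rewrite -lee_fin -sumEFin fineK ?fin_num_measure//.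
under eq_bigr do rewrite fineK ?fin_num_measure//.
have := @measure_bigsetU_ord _ _ _ m _ predT F' (fun i => mF _) tF'.
rewrite /F' => <-; apply: le_measure; rewrite ?inE//.
  by apply: bigsetU_measurable => j _; exact: mF.
elim/big_ind : _ => [|B C BA CA|j _]; [exact: sub0set| |exact: FA].
by rewrite subUset.
Qed.

End finite_families.

(** Cauchy-Schwarz within each [A i] costs the number of cells. The squared mass of a cell is the
    product measure of [P k] times itself, and these squares are disjoint subsets of the
    near-diagonal set [W]. *)
Lemma sum_sqr_cells_le d (T : measurableType d) (R : realType)
    (m : {finite_measure set T -> \bar R}) (I J : finType)
    (A : I -> set T) (P : I * J -> set T) (W : set (T * T)) :
  (forall i, measurable (A i)) -> (forall k, measurable (P k)) -> measurable W ->
  (forall i, A i `<=` \bigcup_j P (i, j)) -> trivIset setT P ->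
  (forall k, P k `*` P k `<=` W) ->
  \sum_i fine (m (A i)) ^+ 2 <= #|J|%:R * fine (finite_prod m m W).
Proof.
move=> mA mP mW AP tP PW.
apply: (@le_trans _ _ (\sum_i #|J|%:R * \sum_j fine (m (P (i, j))) ^+ 2)).
  apply: ler_sum => i _; apply: le_trans (sqr_sum_le predT _).
  rewrite lerXn2r ?nnegrE ?fine_ge0//; first by apply: sumr_ge0 => j _; rewrite fine_ge0.
  exact: fine_measure_le_sum.
rewrite -mulr_sumr ler_wpM2l//.
rewrite pair_big/=.
apply: le_trans (@sum_fine_measure_le _ _ _ (finite_prod m m) _
  (fun k => P k `*` P k) W _ _ _ _) => //.
- rewrite le_eqVlt; apply/orP; left; apply/eqP; apply: eq_bigr => -[i j] _.
  by rewrite /= /finite_prod product_measure1E// fineM ?fin_num_measure// expr2.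
- by move=> k; exact: measurableX.
- move=> k l _ _ [[x y] [[/= Pk _] [Pl _]]]; apply: tP => //; by exists x.
Qed.

Lemma bigcup_countable_measure0 d (T : measurableType d) (R : realType)
    (m : {measure set T -> \bar R}) (I : countType) (F : I -> set T) (D : set I) :
  (forall i, measurable (F i)) -> (forall i, D i -> m (F i) = 0%E) ->
  m (\bigcup_(i in D) F i) = 0%E.
Proof.
move=> mF F0; pose G n := if unpickle n is Some i then (if `[< D i >] then F i else set0) else set0.
have mG n : measurable (G n).
  by rewrite /G; case: unpickle => // i; case: ifP.
have G0 n : m (G n) = 0%E.
  rewrite /G; case: unpickle => [i|]; last exact: measure0.
  by case: asboolP => [/F0//|_]; exact: measure0.
rewrite (_ : \bigcup_(i in D) F i = \bigcup_n G n); last first.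
  apply/seteqP; split => [x [i Di Fi]|x [n _]].
    by exists (pickle i) => //; rewrite /G pickleK asboolT.
  by rewrite /G; case: unpickle => // i; case: asboolP => // Di Fi; exists i.
apply/eqP; rewrite eq_le measure_ge0 andbT.
have := @generalized_Boole_inequality _ _ _ m G mG (bigcup_measurable (fun k _ => mG k)).
by move=> /le_trans; apply; rewrite eseries0.
Qed.

(* x_i^2 - y_i^2 = (|x|^2 - |y|^2) - \sum_(j <> i) (x_j^2 - y_j^2), and on the
   cone every term on the right is O(h (|x_i| + |y_i|)). *)
Lemma normrB_cone (R : realType) (n : nat) (i : 'I_n.+1) (e h : R) (x y : 'rV[R]_n.+1) :
  e ^+ 2 = 1 -> (forall j, `|x ord0 j| <= e * x ord0 i) ->
  (forall j, `|y ord0 j| <= e * y ord0 i) ->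
  (forall j, `|x ord0 (lift i j) - y ord0 (lift i j)| <= h) ->
  `|enorm x - enorm y| <= h -> 0 <= h ->
  `|x ord0 i - y ord0 i| <= (2 * n + 1)%:R * h.
Proof.
move=> e1 cx cy hj hn h0.
set u := e * x ord0 i in cx; set v := e * y ord0 i in cy.
have u0 : 0 <= u by exact: le_trans (cx i).
have v0 : 0 <= v by exact: le_trans (cy i).
have ne : `|e| = 1.
  by apply/eqP; rewrite -(@eqrXn2 _ 2)// real_normK ?num_real// e1 expr1n.
have -> : `|x ord0 i - y ord0 i| = `|u - v|.
  by rewrite /u /v -mulrBr normrM ne mul1r.
have enle (z : 'rV[R]_n.+1) w : (forall j, `|z ord0 j| <= w) -> enorm z <= n.+1%:R * w.
  move=> zw; rewrite (le_trans (enorm_le_sum z))//.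
  rewrite (@le_trans _ _ (\sum_(j < n.+1) w)) ?ler_sum//.
  by rewrite sumr_const card_ord mulr_natl.
have sq (z : 'rV[R]_n.+1) : enorm z ^+ 2 =
    (e * z ord0 i) ^+ 2 + \sum_(j < n) z ord0 (lift i j) ^+ 2.
  by rewrite sqr_enorm (bigD1_ord i)//= exprMn e1 mul1r.
(* The difference of the squared norms contributes [n + 1], because [|x| <= (n + 1) u] and
   [|y| <= (n + 1) v] on the cone; the other coordinates contribute 1 each. *)
have key : `|u ^+ 2 - v ^+ 2| <= (2 * n + 1)%:R * h * (u + v).
  have -> : u ^+ 2 - v ^+ 2 = (enorm x ^+ 2 - enorm y ^+ 2) -
      \sum_(j < n) (x ord0 (lift i j) ^+ 2 - y ord0 (lift i j) ^+ 2).
    by rewrite !sq sumrB -/u -/v; ring.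
  apply: (le_trans (ler_normB _ _)).
  have H1 : `|enorm x ^+ 2 - enorm y ^+ 2| <= h * (n.+1%:R * (u + v)).
    rewrite subr_sqr normrM ler_pM// ger0_norm ?addr_ge0 ?enorm_ge0// mulrDr.
    by rewrite lerD// enle.
  have H2 : `|\sum_(j < n) (x ord0 (lift i j) ^+ 2 - y ord0 (lift i j) ^+ 2)| <=
      n%:R * (h * (u + v)).
    rewrite (le_trans (ler_norm_sum _ _ _))//.
    rewrite (@le_trans _ _ (\sum_(j < n) (h * (u + v))))//; last first.
      by rewrite sumr_const card_ord mulr_natl.
    apply: ler_sum => j _; rewrite subr_sqr normrM ler_pM//.
    by rewrite (le_trans (ler_normD _ _))// lerD.
  rewrite (le_trans (lerD H1 H2))// le_eqVlt; apply/orP; left; apply/eqP.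
  by rewrite -natr1 natrD natrM; ring.
have [uv|uv] := eqVneq (u + v) 0.
  have -> : u - v = 0 by lra.
  by rewrite normr0 mulr_ge0.
have uv0 : 0 < u + v by rewrite lt_neqAle eq_sym uv addr_ge0.
move: key; rewrite subr_sqr normrM (ger0_norm (ltW uv0)).
by rewrite ler_pM2r.
Qed.

Lemma measurable_preimage_itv d (T : measurableType d) (R : realType) (f : T -> R)
    (i : interval R) :
  measurable_fun setT f -> measurable [set z | f z \in i].
Proof.
move=> mf; rewrite -[X in measurable X]setTI.
by apply: (mf measurableT [set` i]); exact: measurable_itv.
Qed.

Section radial.
Context {R : realType} {n : nat}.
Local Notation E := (borelRd R n.+1).

Let cone (i : 'I_n.+1) (b : bool) : set E :=
  [set z | forall j, `|z ord0 j| <= (-1) ^+ b * z ord0 i].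

Let measurable_cone i b : measurable (cone i b).
Proof.
rewrite (_ : cone i b = \bigcap_j [set z : E | (-1) ^+ b * z ord0 i - `|z ord0 j| \in `[0, +oo[]).
  apply: fin_bigcap_measurable => // j _.
  apply: (@measurable_preimage_itv _ E _ (fun z => (-1) ^+ b * z ord0 i - `|z ord0 j|)).
  apply: measurable_funB; first by apply: measurable_funM => //; exact: measurable_coord.
  by apply: measurableT_comp => //; exact: measurable_coord.
apply/seteqP; split => z zc j; last by have := zc j I; rewrite /= in_itv/= andbT subr_ge0.
by move=> _; rewrite /= in_itv/= andbT subr_ge0.
Qed.

Let bigcup_cone : \bigcup_p cone p.1 p.2 = setT.
Proof.
apply/seteqP; split => // z _.
have [i _ imax] := @arg_maxP _ _ _ ord0 predT (fun j => `|z ord0 j|) isT.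
exists (i, z ord0 i < 0) => //= j; rewrite (le_trans (imax j _))//.
by case: ltP => z0; [rewrite ltr0_norm// expr1 mulN1r|rewrite ger0_norm// mul1r].
Qed.

Let piece (p : 'I_n.+1 * bool * nat) : set E :=
  cone p.1.1 p.1.2 `&` [set z | enorm z \in `]-oo, p.2%:R[].

Let measurable_piece p : measurable (piece p).
Proof.
apply: measurableI; first exact: measurable_cone.
exact: (@measurable_preimage_itv _ E _ (fun z => enorm z) _ measurable_enorm_id).
Qed.

(** Countably many truncated cones cover the space, so one of them, [B], has positive mass. In it an
    interval of radii of length [1/M] splits into [(2kM)^n] cells, and two points of a cell are at
    sup-distance at most [K/M]. The correlation bound then gives order
    [M^n M^(-(n + 1 - p)) = M^(p - 1)]. *)
Lemma radial_cells (s : {finite_measure set E -> \bar R}) (C p : R) :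
  0 <= C -> (forall r, 0 < r <= 1 ->
    (finite_prod s s [set q : E * E | forall i, (`|(q.1 - q.2) ord0 i| <= r)%R] <=
     (C * r `^ (n.+1%:R - p))%:E)%E) ->
  (0 < s setT)%E ->
  exists B : set E, exists k K : nat, exists C' : R,
    [/\ measurable B, (0 < s B)%E, (forall z, B z -> enorm z < k%:R), 0 <= C' &
     forall M : nat, (0 < M)%N -> (K <= M)%N ->
       \sum_(m < k * M) fine (s (B `&` [set z | enorm z * M%:R \in `[m%:R, m.+1%:R[])) ^+ 2
         <= C' * M%:R `^ (p - 1)].
Proof.
move=> C0 corr s0.
have [[[i b] k] s_gt0] : exists q, (0 < s (piece q))%E.
  apply: contrapT => /forallNP H; move: s0; rewrite ltNge; apply/negP; rewrite negbK.
  have := @bigcup_countable_measure0 _ _ _ s _ piece setT measurable_piece.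
  rewrite (_ : \bigcup_(q in setT) piece q = setT).
    by move=> ->// q _; apply/eqP; rewrite eq_le measure_ge0 andbT leNgt; apply/negP/H.
  apply/seteqP; split => // z _.
  have : setT z by []. rewrite -bigcup_cone => -[[i b] _ zc].
  exists (i, b, (Num.truncn (enorm z)).+1) => //; split => //=.
  by rewrite in_itv/= truncnS_gt.
set B := piece _ in s_gt0; pose K := (2 * n + 1)%N.
have K0 : 0 < K%:R :> R by rewrite ltr0n /K addn1.
exists B, k, K, ((2 * k)%:R ^+ n * (C * K%:R `^ (n.+1%:R - p))); split => //.
- exact: measurable_piece.
- by move=> z [_]; rewrite /= in_itv.
- by rewrite mulr_ge0 ?exprn_ge0// mulr_ge0// powR_ge0.
move=> M M0 KM; have MR : 0 < M%:R :> R by rewrite ltr0n.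
(* On [B] the coordinates lie in [(-k, k)]. Shifting them by [k] makes them nonnegative, so that
   truncation gives an index in [[0, 2kM)]. *)
pose N := (2 * k * M)%N.
pose A (m : nat) := B `&` [set z | enorm z * M%:R \in `[m%:R, m.+1%:R[].
pose P (q : 'I_(k * M) * {ffun 'I_n -> 'I_N}) : set E := A q.1 `&`
  \bigcap_j [set z | (z ord0 (lift i j) + k%:R) * M%:R \in `[(q.2 j)%:R, (q.2 j).+1%:R[].
(* [K] is the factor lost in [normrB_cone]; the condition [K <= M] keeps [r] in the range of the
   correlation bound. *)
pose r : R := K%:R / M%:R.
have r01 : 0 < r <= 1 by rewrite divr_gt0//= ler_pdivrMr// mul1r ler_nat.
have mA m : measurable (A m).
  apply: measurableI; first exact: measurable_piece.
  apply: (@measurable_preimage_itv _ E _ (fun z => enorm z * M%:R)).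
  by apply: measurable_funM => //; exact: measurable_enorm_id.
have near1 (u v : R) (m : nat) : u * M%:R \in `[m%:R, m.+1%:R[ -> v * M%:R \in `[m%:R, m.+1%:R[ ->
    `|u - v| <= M%:R^-1.
  rewrite !in_itv/= => /andP[u1 u2] /andP[v1 v2].
  rewrite -[leRHS]mul1r ler_pdivlMr// -(ger0_norm (ltW MR)) -normrM mulrBl.
  rewrite ler_norml -natr1 in u2 v2 *; apply/andP; split; lra.
have uniqm (u : R) (m1 m2 : nat) : u \in `[m1%:R, m1.+1%:R[ -> u \in `[m2%:R, m2.+1%:R[ -> m1 = m2.
  rewrite !in_itv/= => /andP[u1 u2] /andP[v1 v2]; apply/eqP; rewrite eqn_leq.
  by apply/andP; split; rewrite -ltnS -(@ltr_nat R); [exact: le_lt_trans v2|exact: le_lt_trans u2].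
have coordk z j : B z -> 0 <= (z ord0 j + k%:R) * M%:R < N%:R.
  move=> [_]; rewrite /= in_itv/= => zk.
  have := le_lt_trans (normr_le_enorm z j) zk; rewrite ltr_norml => /andP[zk1 zk2].
  rewrite mulr_ge0 ?(ltW MR)//=; last lra.
  by rewrite /N natrM ltr_pM2r// natrM; lra.
have mW : measurable [set q : E * E | forall i, (`|(q.1 - q.2) ord0 i| <= r)%R].
  rewrite -[X in measurable X]setTI.
  exact: (measurable_rowB_prod _ (measurable_row_normr_le r)).
apply: (@le_trans _ _ (#|{ffun 'I_n -> 'I_N}|%:R *
    fine (finite_prod s s [set q : E * E | forall i, (`|(q.1 - q.2) ord0 i| <= r)%R]))).
  apply: (@sum_sqr_cells_le _ _ _ s 'I_(k * M) {ffun 'I_n -> 'I_N} (fun m => A m) P).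
  - by move=> m; exact: mA.
  - move=> q; apply: measurableI; first exact: mA.
    apply: fin_bigcap_measurable => // j _.
    apply: (@measurable_preimage_itv _ E _ (fun z => (z ord0 (lift i j) + k%:R) * M%:R)).
    apply: measurable_funM => //; apply: measurable_funD => //; exact: measurable_coord.
  - exact: mW.
  - move=> m z [Bz Az].
    have lt j : (Num.truncn ((z ord0 (lift i j) + k%:R) * M%:R) < N)%N.
      have /andP[z1 z2] := coordk z (lift i j) Bz.
      by rewrite -(@ltr_nat R) (le_lt_trans _ z2)// truncn_le.
    exists [ffun j => Ordinal (lt j)] => //; split => // j _ /=; rewrite ffunE/= in_itv/=.
    by have /andP[z1 _] := coordk z (lift i j) Bz; exact: truncn_itv.
  - move=> [m1 c1] [m2 c2] _ _ [z [[[_ /= a1] /= b1] [[_ /= a2] /= b2]]]; congr (_, _).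
      by apply: val_inj; exact: uniqm a1 a2.
    by apply/ffunP => j; apply: val_inj; exact: uniqm (b1 j I) (b2 j I).
  - move=> [m c] [x y] [/= [[Bx ax] bx] [[By ay] by_]] j /=; rewrite !mxE.
    have hl j' : `|x ord0 (lift i j') - y ord0 (lift i j')| <= M%:R^-1.
      have := near1 _ _ _ (bx j' I) (by_ j' I).
      by rewrite (_ : _ - _ = x ord0 (lift i j') - y ord0 (lift i j'))//; ring.
    have Mr : M%:R^-1 <= r by rewrite /r -[leLHS]mul1r ler_pM2r ?invr_gt0// ler1n /K addn1.
    case: (unliftP i j) => [j'|] ->; first exact: le_trans (hl j') Mr.
    apply: (normrB_cone (e := (-1) ^+ b)) hl _ _.
    + by rewrite -exprM mulnC exprM sqrrN !expr1n.
    + by case: Bx.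
    + by case: By.
    + exact: near1 ax ay.
    + by rewrite invr_ge0 ltW.
rewrite card_ffun !card_ord.
have H := corr r r01; set W := finite_prod s s _ in H *.
have Wfin : W \is a fin_num by exact: fin_num_measure.
have W1 : fine W <= C * r `^ (n.+1%:R - p).
  by rewrite -lee_fin fineK.
apply: (@le_trans _ _ (N%:R ^+ n * (C * r `^ (n.+1%:R - p)))).
  by rewrite natrX ler_wpM2l// exprn_ge0.
rewrite /N natrM exprMn /r powRM ?invr_ge0 ?ler0n//.
rewrite le_eqVlt; apply/orP; left; apply/eqP.
rewrite -(powR_inv1 (ltW MR)) -powRrM -(powR_mulrn n (ltW MR)).
have -> : p - 1 = n%:R + (-1) * (n.+1%:R - p) by rewrite -natr1; ring.
by rewrite [M%:R `^ (n%:R + _)]powRD ?(gt_eqF MR) ?implybT//; ring.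
Qed.

End radial.

(** * Supports of Borel measures *)

Section support.
Context {R : realType} {d : nat}.
Local Notation E := (borelRd R d).
Variable mu : {measure set E -> \bar R}.

Let box (q : 'rV[rat]_d * nat) : set 'rV[R]_d :=
  ball (map_mx ratr q.1 : 'rV[R]_d) q.2.+1%:R^-1.

Let open_box q : open (box q).
Proof. by apply: ball_open. Qed.

Let box_inside (U : set 'rV[R]_d) x : open U -> U x ->
  exists q, box q x /\ box q `<=` U.
Proof.
move=> oU Ux.
have /nbhs_ballP[e /= e0 xeU] : nbhs x U by exact: open_nbhs_nbhs.
have [k ke] : exists k : nat, k.+1%:R^-1 < e / 2.
  have : \forall k \near \oo, k.+1%:R^-1 < e / 2.
    by apply: near_infty_natSinv_lt (PosNum (divr_gt0 e0 (ltr0n _ 2))).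
  by move=> [k _ /(_ k (leqnn _))]; exists k.
have k0 : 0 < k.+1%:R^-1 :> R by rewrite invr_gt0.
have /choice[q qP] : forall j, exists q : rat,
    `|ratr q - x ord0 j| < k.+1%:R^-1 :> R.
  move=> j; have [|q] := @rat_in_itvoo R (x ord0 j) (x ord0 j + k.+1%:R^-1).
    by rewrite ltrDl.
  rewrite in_itv/= => /andP[xq qx]; exists q.
  by rewrite ger0_norm ?subr_ge0 ?ltW// ltrBlDl.
have xq : box (\row_j q j, k) x.
  by split=> // i j; rewrite (ord1 i) !mxE -ball_normE /=; exact: qP.
exists (\row_j q j, k); split => // y yq; apply: xeU.
have le_e2 : k.+1%:R^-1 <= e / 2 by exact: ltW.
apply: (@ball_splitr _ _ (map_mx ratr (\row_j q j) : 'rV[R]_d)).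
  by move: xq; apply: le_ball.
by move: yq; apply: le_ball.
Qed.

Let null_boxes := [set q | mu (box q) = 0%E].

(** Second countability: a null open neighbourhood contains a null box with rational centre and
    radius [1/(m + 1)] around the point. As there are countably many such boxes, the complement of
    the support is null and the support is Borel. *)
Let sptC : ~` spt mu = \bigcup_(q in null_boxes) box q.
Proof.
apply/seteqP; split => [x /existsNP[U /not_implyP[oU /not_implyP[Ux]]]|x [q q0 qx]].
  move=> /negP; rewrite -leNgt => U0; have [q [qx qU]] := box_inside oU Ux.
  exists q => //; apply/eqP; rewrite eq_le measure_ge0 andbT (le_trans _ U0)//.
  by apply: le_measure; rewrite ?inE//; apply: sub_sigma_algebra => //; exact: open_box.
by move=> /(_ _ (@open_box q) qx); rewrite q0 ltxx.
Qed.

Lemma measure_setC_spt : mu (~` spt mu) = 0%E.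
Proof.
rewrite sptC; apply: bigcup_countable_measure0 => // q.
by apply: sub_sigma_algebra; exact: open_box.
Qed.

Lemma measurable_spt : measurable (spt mu : set E).
Proof.
rewrite -[spt mu]setCK; apply: measurableC; rewrite sptC.
have -> : \bigcup_(q in null_boxes) box q = \bigcup_q (if `[< null_boxes q >] then box q else set0).
  apply/seteqP; split => [x [q q0 qx]|x [q _]].
    by exists q => //; rewrite asboolT.
  by case: asboolP => // q0 qx; exists q.
apply: countable_bigcupT_measurable => [|q]; first exact: countableP.
by case: ifP => // _; apply: sub_sigma_algebra; exact: open_box.
Qed.

End support.

(** * Lower bounds for the distance set *)

Lemma card_itv_ord_le (n m0 q : nat) :
  (#|[pred m : 'I_n | (m0 <= m < m0 + q)%N]| <= q)%N.
Proof.
set A := [pred m : 'I_n | _].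
have -> : #|A| = size [seq val m | m <- enum A] by rewrite size_map -cardE.
rewrite -[leqRHS](size_iota m0); apply: uniq_leq_size.
  by rewrite map_inj_uniq ?enum_uniq//; exact: val_inj.
move=> m; case/mapP => i; rewrite mem_enum inE mem_iota => + ->; exact.
Qed.

Lemma le_add_divn (R : realType) (x y c : R) (K : nat) : 0 <= c ->
  (forall M, (0 < M)%N -> (K <= M)%N -> x <= y + c / M%:R) -> x <= y.
Proof.
move=> c0 H; rewrite leNgt; apply/negP => yx.
have xy : 0 < x - y by rewrite subr_gt0.
pose M := (K + (Num.truncn (c / (x - y))).+1)%N.
have M0 : 0 < M%:R :> R by rewrite ltr0n /M addnS.
have := H M; rewrite -(ltr0n R) => /(_ M0 (leq_addr _ _)); rewrite -lerBlDl.
rewrite ler_pdivlMr// mulrC -ler_pdivlMr// => HM.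
have := truncnS_gt (c / (x - y)); apply/negP; rewrite -leNgt (le_trans _ HM)//.
by rewrite ler_nat /M leq_addl.
Qed.

(** For [r > 0] the scale is the dyadic number with [r <= 2^(-j) < 2 r]. A set of diameter 0 has no
    such scale; the slack [eta] covers it by taking [j] large. *)
Lemma dyadic_scale (R : realType) (r s eta : R) (j0 : nat) :
  0 <= s -> 0 <= r <= ((2 ^ j0)%:R)^-1 -> 0 < eta ->
  exists j, [/\ (j0 <= j)%N, r <= ((2 ^ j)%:R)^-1 &
    (2 ^ j)%:R `^ (- s) <= 2 `^ s * r `^ s + eta].
Proof.
move=> s0 /andP[r0 rj0] eta0.
have p2 j : 0 < (2 ^ j)%:R :> R by rewrite ltr0n expn_gt0.
have big (y : R) : exists j, (j0 <= j)%N /\ y <= (2 ^ j)%:R.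
  exists (j0 + (Num.truncn y).+1)%N; rewrite leq_addr; split => //.
  rewrite ltW// (lt_le_trans (truncnS_gt y))// ler_nat.
  by rewrite (leq_trans (leq_addl j0 _))// ltnW// ltn_expl.
move: r0; rewrite le_eqVlt => /predU1P[<-|r0].
  move: s0; rewrite le_eqVlt => /predU1P[<-|s0].
    (* With [s = 0] and [r = 0] the convention that 0 to the power 0 is 1 matters: both powers equal
       1. *)
    by exists j0; split => //; rewrite oppr0 !powRr0 mul1r lerDl ltW.
  (* [2^j >= eta^(-1/s)] is equivalent to [2^(-j s) <= eta]. *)
  have [j [jj0 jy]] := big (eta `^ (- s^-1)).
  exists j; split => //.
  rewrite (powR0 (lt0r_neq0 s0)) mulr0 add0r powRN.
  rewrite -[leRHS]invrK lef_pV2 ?posrE ?powR_gt0 ?invr_gt0//.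
  have -> : eta^-1 = (eta `^ (- s^-1)) `^ s.
    by rewrite -powRrM mulNr mulVf ?gt_eqF// powR_inv1// ltW.
  by rewrite ge0_ler_powR ?nnegrE ?powR_ge0// ltW.
have ex : exists j, (2 ^ j)%:R^-1 < r.
  have [j [_ jy]] := big (r^-1 + 1); exists j.
  rewrite -[ltRHS]invrK ltf_pV2 ?posrE ?invr_gt0// (lt_le_trans _ jy)//.
  by rewrite ltrDl.
(* The witness is the predecessor of the least exponent with [2^(-j) < r]; exponent 0 would mean
   [r > 1]. *)
case: (ex_minnP ex) => -[|j] Pj minj.
  have := lt_le_trans Pj rj0; rewrite expn0 invr1 ltNge; case/negP.
  by rewrite -[leRHS]invr1 lef_pV2 ?posrE ?p2// ler1n expn_gt0.
exists j; split.
- rewrite leqNgt; apply/negP => jj0; have := lt_le_trans Pj rj0.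
  by rewrite ltf_pV2 ?posrE// ltr_nat ltn_exp2l// ltnNge jj0.
- by rewrite leNgt; apply/negP => /minj; rewrite ltnn.
rewrite (@le_trans _ _ (2 `^ s * r `^ s))//; last by rewrite lerDl ltW.
rewrite -powRM ?(ltW r0)// powRN -powR_inv1 ?(ltW (p2 _))// -powRAC.
rewrite powR_inv1 ?(ltW (p2 _))//.
rewrite ge0_ler_powR ?nnegrE ?invr_ge0 ?(ltW (p2 _)) ?mulr_ge0 ?(ltW r0)// ltW//.
by move: Pj; rewrite expnS natrM invfM ltr_pdivrMl.
Qed.

Section distances.
Context dT (T : measurableType dT) (R : realType) (s : {finite_measure set T -> \bar R}).
Variables (f : T -> R) (B : set T) (k K : nat) (C t : R).
Hypothesis mf : measurable_fun setT f.
Hypothesis mB : measurable B.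
Hypothesis sB : (0 < s B)%E.
Hypothesis fB : forall z, B z -> 0 <= f z < k%:R.
Hypothesis C0 : 0 <= C.

Let cell (M m : nat) := B `&` [set z | f z * M%:R \in `[m%:R, m.+1%:R[].

Hypothesis cells : forall M : nat, (0 < M)%N -> (K <= M)%N ->
  \sum_(m < k * M) fine (s (cell M m)) ^+ 2 <= C * M%:R `^ (- t).

Let measurable_cell M m : measurable (cell M m).
Proof.
apply: measurableI => //; apply: (@measurable_preimage_itv _ T _ (fun z => f z * M%:R)).
exact: measurable_funM.
Qed.

Let in_cell M z : (0 < M)%N -> B z ->
  cell M (Num.truncn (f z * M%:R)) z /\ (Num.truncn (f z * M%:R) < k * M)%N.
Proof.
move=> M0 Bz; have /andP[z0 zk] := fB Bz; have MR : 0 < M%:R :> R by rewrite ltr0n.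
have zM : 0 <= f z * M%:R by rewrite mulr_ge0.
split; first by split => //=; rewrite in_itv/=; exact: truncn_itv.
by rewrite -(ltr_nat R) natrM (@le_lt_trans _ _ (f z * M%:R)) ?truncn_le// ltr_pM2r.
Qed.

Let measure_le_cells M (A : set T) (J : pred nat) : (0 < M)%N -> measurable A ->
  A `<=` B -> (forall z, A z -> J (Num.truncn (f z * M%:R))) ->
  fine (s A) <= \sum_(m in [pred m : 'I_(k * M) | J m]) fine (s (cell M m)).
Proof.
move=> M0 mA AB AJ.
pose F (m : 'I_(k * M)) := if J m then cell M m else set0.
rewrite [leRHS]big_mkcond/=.
rewrite (_ : \sum_(m < k * M) _ = \sum_(m < k * M) fine (s (F m))); last first.
  by apply: eq_bigr => m _; rewrite inE /F; case: ifP => //; rewrite measure0.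
apply: fine_measure_le_sum => //.
  by move=> m; rewrite /F; case: ifP.
move=> z Az; have [zc lt] := in_cell M0 (AB _ Az).
by exists (Ordinal lt) => //; rewrite /F /= AJ.
Qed.

Let sqr_measure_le_cells M (A : set T) (J : pred nat) (q : nat) : (0 < M)%N -> (K <= M)%N ->
  measurable A -> A `<=` B -> (forall z, A z -> J (Num.truncn (f z * M%:R))) ->
  (#|[pred m : 'I_(k * M) | J m]| <= q)%N ->
  fine (s A) ^+ 2 <= q%:R * (C * M%:R `^ (- t)).
Proof.
move=> M0 KM mA AB AJ Jq.
have H := measure_le_cells M0 mA AB AJ.
apply: (@le_trans _ _ ((\sum_(m in [pred m : 'I_(k * M) | J m]) fine (s (cell M m))) ^+ 2)).
  by rewrite lerXn2r// nnegrE ?sumr_ge0// => *; rewrite fine_ge0.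
apply: (le_trans (sqr_sum_le _ _)); apply: ler_pM => //.
- by apply: sumr_ge0 => i _; exact: sqr_ge0.
- by rewrite ler_nat.
apply: le_trans (cells M0 KM); rewrite big_mkcond/=; apply: ler_sum => m _.
by case: ifP => // _; exact: sqr_ge0.
Qed.

Section intervals.
Hypothesis t1 : t = 1.

(** [N] intervals of total length [L] meet at most [L M + 2 N] cells of length [1/M], so
    Cauchy-Schwarz bounds the squared mass by [(L M + 2 N) C / M]. For [t = 1] the main term does
    not depend on [M], and the boundary term vanishes as [M] grows. *)
Let sqr_measure_le_itv (a b : nat -> R) N : (forall i, a i <= b i) ->
  fine (s (B `&` f @^-1` (\bigcup_(i in `I_N) `]a i, b i]%classic))) ^+ 2 <=
  C * \sum_(i < N) (b i - a i).
Proof.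
move=> ab; set A := B `&` _.
have mA : measurable A.
  apply: measurableI => //; rewrite -[X in measurable X]setTI; apply: mf => //.
  by apply: bigcup_measurable => i _; exact: measurable_itv.
apply: (@le_add_divn _ _ _ (C * (2 * N)%:R) K); first by rewrite mulr_ge0.
move=> M M0 KM; have MR : 0 < M%:R :> R by rewrite ltr0n.
pose m0 i := Num.truncn (a i * M%:R).
(* The 2 allows for the two partially covered cells at the ends. *)
pose q i := (Num.truncn ((b i - a i) * M%:R) + 2)%N.
pose J := [pred m : nat | [exists i : 'I_N, (m0 i <= m < m0 i + q i)%N]].
have := @sqr_measure_le_cells M A J (\sum_(i < N) q i)%N M0 KM mA (@subIsetl _ _ _).
have AJ z : A z -> J (Num.truncn (f z * M%:R)).
  move=> [Bz [i /= iN]]; rewrite in_itv/= => /andP[az zb].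
  have /andP[z0 _] := fB Bz.
  have zM : 0 <= f z * M%:R by rewrite mulr_ge0 ?(ltW MR).
  apply/existsP; exists (Ordinal iN) => /=; apply/andP; split.
    by apply: le_truncn; rewrite ler_pM2r// ltW.
  rewrite -(ltr_nat R) (@le_lt_trans _ _ (f z * M%:R)) ?truncn_le//.
  have h1 := truncnS_gt (a i * M%:R); have h2 := truncnS_gt ((b i - a i) * M%:R).
  have h3 : f z * M%:R <= b i * M%:R by rewrite ler_pM2r.
  rewrite natrD /q natrD -/(m0 i); move: h1 h2; rewrite -!natr1 -/(m0 i); nra.
have Jq : (#|[pred m : 'I_(k * M) | J m]| <= \sum_(i < N) q i)%N.
  rewrite (@leq_trans (\sum_(i < N)
      #|[pred m : 'I_(k * M) | (m0 i <= m < m0 i + q i)%N]|)%N)//; last first.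
    by apply: leq_sum => i _; exact: card_itv_ord_le.
  rewrite -sum1_card (eq_bigr (fun=> 1%N))//.
  under [leqRHS]eq_bigr do rewrite -sum1_card big_mkcond/=.
  rewrite exchange_big/= big_mkcond/=; apply: leq_sum => m _; rewrite inE.
  case: ifP => // /existsP[i im]; rewrite (bigD1 i)//= inE im; exact: leq_addr.
move=> /(_ AJ Jq) H; apply: (le_trans H).
rewrite t1 powR_inv1 ?(ltW MR)// natr_sum.
apply: (@le_trans _ _ ((\sum_(i < N) ((b i - a i) * M%:R + 2)) * (C / M%:R))).
  rewrite ler_wpM2r ?divr_ge0// ler_sum// => i _.
  by rewrite /q natrD lerD2r truncn_le mulr_ge0// subr_ge0.
rewrite big_split/= -mulr_suml sumr_const card_ord natrM -mulr_natl.
by rewrite le_eqVlt; apply/orP; left; apply/eqP; field; rewrite gt_eqF.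
Qed.

(** If [D] were null, it would be covered by half-open intervals of total length below [e]. The
    bound for finitely many intervals passes to the whole cover by continuity from below, while the
    cover must carry all the mass of [B]; hence [s(B)^2 <= C e < s(B)^2]. *)
Lemma lebesgue_measure_distances_gt0 (D : set R) :
  (forall V, measurable V -> D `<=` V -> s (B `\` f @^-1` V) = 0%E) ->
  (0 < @lebesgue_measure R D)%E.
Proof.
move=> cov; rewrite lt0e measure_ge0 andbT; apply/eqP => D0.
have b0 : 0 < fine (s B) by rewrite fine_gt0// sB ltey_eq fin_num_measure.
(* [C + 1] instead of [C], which may vanish; it also makes the final inequality strict. *)
pose e := fine (s B) ^+ 2 / (C + 1).
have C1 : 0 < C + 1 by rewrite ltr_wpDl.
have e0 : 0 < e by rewrite divr_gt0// exprn_gt0.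
have : (@lebesgue_measure R D < e%:E)%E by rewrite D0 lte_fin.
rewrite /lebesgue_measure /lebesgue_stieltjes_measure /measure_extension /mu_ext.
move=> /ereal_inf_lt[_ [F [mF DF] <-]] Fe.
have /choice[ab abP] : forall i, exists ab : R * R,
    [/\ F i = `]ab.1, ab.2]%classic, ab.1 <= ab.2 & wlength idfun (F i) = (ab.2 - ab.1)%:E].
  move=> i; have [[a b] _ /= Fab] := mF i.
  have [ab|ba] := leP a b.
    by exists (a, b); rewrite -Fab; split => //; rewrite wlength_itv_bnd.
  (* Reversed endpoints describe the empty set, rewritten here as []a, a]] so that every interval
     has ordered endpoints. *)
  exists (a, a) => /=; rewrite -Fab; split => //.
    by rewrite !set_itv_ge// -leNgt ?bnd_simp// ltW.
  by rewrite wlength_itv/= lte_fin ltNge (ltW ba)/= subrr.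
pose a i := (ab i).1; pose b i := (ab i).2.
have ab_le i : a i <= b i by have [] := abP i.
pose V := \bigcup_i F i.
have mFi i : measurable (F i : set R).
  by have [-> _ _] := abP i; exact: measurable_itv.
have mV : measurable (V : set R) by exact: bigcup_measurable.
pose U N := B `&` f @^-1` (\bigcup_(i in `I_N) F i).
have mU N : measurable (U N).
  apply: measurableI => //; rewrite -[X in measurable X]setTI; apply: mf => //.
  exact: bigcup_measurable.
have UE : \bigcup_N U N = B `&` f @^-1` V.
  apply/seteqP; split => z.
    by move=> [N _ [Bz [i _ Fi]]]; split => //; exists i.
  by move=> [Bz [i _ Fi]]; exists i.+1 => //; split => //; exists i => //=.
have Ule N : (s (U N) <= (Num.sqrt (C * e))%:E)%E.
  rewrite -[leLHS]fineK ?fin_num_measure// lee_fin -[leLHS]ger0_norm ?fine_ge0//.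
  rewrite -sqrtr_sqr ler_wsqrtr//.
  have := sqr_measure_le_itv N ab_le.
  rewrite (_ : \bigcup_(i in `I_N) `]a i, b i]%classic = \bigcup_(i in `I_N) F i); last first.
    by apply: eq_bigcupr => i _; have [-> _ _] := abP i.
  move=> /le_trans; apply; rewrite ler_wpM2l// -lee_fin -sumEFin.
  apply: le_trans (ltW Fe).
  rewrite (eq_bigr (fun i : 'I_N => wlength idfun (F i))); last first.
    by move=> i _; have [_ _ ->] := abP i.
  rewrite -(big_mkord predT (fun i => wlength idfun (F i))).
  apply: nneseries_lim_ge => i _ _; have [_ H ->] := abP i.
  by rewrite lee_fin subr_ge0.
have : (s (B `&` f @^-1` V) <= (Num.sqrt (C * e))%:E)%E.
  rewrite -UE.
  have ndU : nondecreasing_seq U.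
    move=> m n mn; apply/subsetPset => z [Bz [i /= im Fi]]; split => //.
    by exists i => //=; exact: leq_trans mn.
  have cU := @nondecreasing_cvg_mu _ _ _ s U mU (bigcupT_measurable U mU) ndU.
  rewrite -(cvg_lim _ cU)//; apply: lime_le; first by apply/cvg_ex; eexists; exact: cU.
  by near=> N; exact: Ule.
have -> : s (B `&` f @^-1` V) = s B.
  have mfV : measurable (f @^-1` V) by rewrite -[X in measurable X]setTI; exact: mf.
  have c0 := cov V mV DF.
  transitivity (s (B `\` f @^-1` V) + s (B `&` f @^-1` V))%E; first by rewrite c0 add0e.
  exact: esym (measureDI s mB mfV).
rewrite -[leLHS]fineK ?fin_num_measure// lee_fin.
rewrite -(@ler_pXn2r _ 2) ?nnegrE ?sqrtr_ge0 ?(ltW b0)// sqr_sqrtr ?(mulr_ge0 C0 (ltW e0))//.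
rewrite /e mulrA ler_pdivlMr// mulrC ler_pM2r ?exprn_gt0// => HC.
move: HC. by rewrite leNgt ltrDl ltr01.
Unshelve. all: by end_near. Qed.

End intervals.

Section hausdorff.
Variables (e : R).
Hypothesis e0 : 0 <= e.
Hypothesis et : e < t.

Let p2 j : 0 < (2 ^ j)%:R :> R.
Proof. by rewrite ltr0n expn_gt0. Qed.

Let heavy j m := (2 ^ j)%:R `^ (- e) < fine (s (cell (2 ^ j) m)).

Let bad j := \bigcup_(m in [set m | heavy j m]) cell (2 ^ j) m.

Let measurable_bad j : measurable (bad j).
Proof. by apply: bigcup_measurable => m _. Qed.

Let q := 2 `^ (e - t) : R.

Let q0 : 0 < q. Proof. exact: powR_gt0. Qed.

Let q1 : q < 1.
Proof.
by rewrite /q /powR pnatr_eq0 /= -[ltRHS]expR0 ltr_expR nmulr_rlt0 ?subr_lt0// ln_gt0 ?ltr1n.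
Qed.

(** Chebyshev's argument: the mass of a heavy cell is at most [2^(j e)] times its square, so the
    total is at most [2^(j e) C 2^(-j t)], which decays geometrically because [e < t]. *)
Let measure_bad j : (K <= 2 ^ j)%N -> fine (s (bad j)) <= C * q ^+ j.
Proof.
move=> Kj; have M0 : (0 < 2 ^ j)%N by rewrite expn_gt0.
have bB : bad j `<=` B by move=> z [m _ []].
have bJ z : bad j z -> heavy j (Num.truncn (f z * (2 ^ j)%:R)).
  move=> [m /= hm [Bz /=]]; rewrite in_itv/= => zm.
  rewrite (_ : Num.truncn _ = m)//; apply/eqP; rewrite truncn_eq//.
  by case/andP: zm => + _; apply: le_trans.
apply: (le_trans (measure_le_cells M0 (measurable_bad j) bB bJ)).
have -> : C * q ^+ j = (2 ^ j)%:R `^ e * (C * (2 ^ j)%:R `^ (- t)).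
  rewrite mulrCA -powRD ?(gt_eqF (p2 j)) ?implybT//; congr (_ * _).
  have e1 : (2 ^ j)%:R = 2 `^ j%:R :> R by rewrite powR_mulrn// natrX.
  have e2 := powR_mulrn j (powR_ge0 2 (e - t)).
  by rewrite e1 /q -e2 -(powRrM 2 (e - t)) -(powRrM 2 j%:R) mulrC.
apply: le_trans (ler_wpM2l (powR_ge0 _ _) (cells M0 Kj)).
rewrite mulr_sumr [leLHS]big_mkcond/=; apply: ler_sum => m _; rewrite inE.
case: ifP => [|_]; last by rewrite mulr_ge0 ?powR_ge0 ?sqr_ge0.
rewrite /heavy powRN => /ltW hm; rewrite expr2 mulrA ler_peMl ?fine_ge0//.
by rewrite mulrC -ler_pdivrMr ?powR_gt0// mul1r.
Qed.

Let good_set : exists j0, exists G, [/\ measurable G, (0 < s G)%E, G `<=` B &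
  forall j z, (j0 <= j)%N -> G z -> ~ heavy j (Num.truncn (f z * (2 ^ j)%:R))].
Proof.
have b0 : 0 < fine (s B) by rewrite fine_gt0// sB ltey_eq fin_num_measure.
have q10 : 0 < 1 - q by rewrite subr_gt0.
(* By measure_bad the heavy cells of levels j >= j0 have total mass at most
   C q^j0 / (1 - q). *)
have [j0 [Kj0 small]] : exists j0, (K <= j0)%N /\ C * q ^+ j0 / (1 - q) < fine (s B).
  have : (fun n => C * q ^+ n / (1 - q)) @ \oo --> (0 : R).
    have : (fun n => C * q ^+ n / (1 - q)) @ \oo --> C * 0 / (1 - q).
      apply: cvgM; last exact: cvg_cst.
      apply: cvgM; first exact: cvg_cst.
      by apply: cvg_expr; rewrite ger0_norm ?(ltW q0).
    by rewrite mulr0 mul0r.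
  move=> /cvgrPdist_lt/(_ _ b0)[n _ H]; exists (maxn K n); rewrite leq_maxl; split => //.
  have := H _ (leq_maxr K n); rewrite sub0r normrN ger0_norm//.
  by rewrite divr_ge0 ?mulr_ge0 ?exprn_ge0 ?(ltW q0) ?(ltW q10).
pose Bad := \bigcup_i bad (j0 + i)%N.
have mBad : measurable Bad by apply: bigcup_measurable => i _.
have badsum n : \sum_(0 <= i < n) fine (s (bad (j0 + i)%N)) <= C * q ^+ j0 / (1 - q).
  apply: (@le_trans _ _ (C * q ^+ j0 * \sum_(0 <= i < n) q ^+ i)).
    rewrite mulr_sumr; apply: ler_sum => i _; rewrite -mulrA -exprD.
    apply: measure_bad; rewrite (leq_trans Kj0)// (leq_trans (leq_addr i _))//.
    by rewrite ltnW// ltn_expl.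
  rewrite ler_wpM2l ?mulr_ge0 ?exprn_ge0 ?(ltW q0)//.
  rewrite -[leRHS]mul1r ler_pdivlMr// big_mkord mulrC.
  have -> : (1 - q) * \sum_(i < n) q ^+ i = 1 - q ^+ n by rewrite -[RHS]opprB subrX1; ring.
  by rewrite gerBl exprn_ge0// ltW.
have sBad : (s Bad <= (C * q ^+ j0 / (1 - q))%:E)%E.
  apply: (le_trans (@generalized_Boole_inequality _ _ _ s (fun i => bad (j0 + i)%N)
    (fun i => @measurable_bad _) mBad)).
  apply: lime_le; first exact: is_cvg_nneseries.
  near=> n; rewrite (eq_bigr (fun i => (fine (s (bad (j0 + i)%N)))%:E)).
    by rewrite sumEFin lee_fin.
  by move=> i _; rewrite fineK ?fin_num_measure.
exists j0, (B `\` Bad); split.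
- exact: measurableD.
- rewrite lt0e measure_ge0 andbT; apply/eqP => s0.
  have : (s B <= s Bad)%E.
    rewrite [leLHS](measureDI s mB mBad) [X in (X + _)%E]s0 add0e.
    by apply: le_measure; rewrite ?inE; [exact: measurableI|exact: mBad|exact: subIsetr].
  move=> /le_trans/(_ sBad); rewrite -[leLHS]fineK ?fin_num_measure// lee_fin.
  by rewrite leNgt small.
- by move=> z [].
- move=> j z jj0 [Bz nb] h; apply: nb; exists (j - j0)%N => //; rewrite subnKC//.
  exists (Num.truncn (f z * (2 ^ j)%:R)) => //.
  by apply: (in_cell _ Bz).1; rewrite expn_gt0.
Unshelve. all: by end_near. Qed.

(** The mass distribution principle on [G]: a covering set of diameter at most [2^(-j)] touches at
    most three dyadic intervals of level [j], and those meeting the image of [G] are light. A cover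
    with small sum of powers would therefore give [G] too little mass. *)
Lemma hausdorff_measure_distances_neq0 (D : set R) : (forall x, D x -> 0 <= x) ->
  (forall V, measurable V -> D `<=` V -> s (B `\` f @^-1` V) = 0%E) ->
  hausdorff_measure e D <> 0%E.
Proof.
move=> Dge0 cov H0.
have [j0 [G [mG sG GB Glight]]] := good_set.
have g0 : 0 < fine (s G) by rewrite fine_gt0// sG ltey_eq fin_num_measure.
(* Three cells per covering set, and the factor [2^e] lost in [dyadic_scale]. *)
pose c : R := 3 * 2 `^ e.
have c0 : 0 < c by rewrite mulr_gt0// powR_gt0.
(* Makes the final bound [c eta + eta] equal to [s(G) - eta], a contradiction. *)
pose eta : R := fine (s G) / (c + 2).
have c2 : 0 < c + 2 by rewrite addr_gt0.
have eta0 : 0 < eta by rewrite divr_gt0.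
(* Diameters at most [2^(-j0)] allow every scale to be taken at a level [j >= j0], where [G] avoids
   the heavy cells. *)
have delta0 : 0 < (2 ^ j0)%:R^-1 :> R by rewrite invr_gt0.
have : (hausdorff_premeasure e (2 ^ j0)%:R^-1 D < eta%:E)%E.
  apply: (@le_lt_trans _ _ 0%E); last by rewrite lte_fin.
  by rewrite -H0; apply: ereal_sup_ubound; exists (2 ^ j0)%:R^-1.
move=> /ereal_inf_lt[_ [F [DF Fd] <-] Fe].
(* Covering sets are arbitrary. Replacing the nonnegative part of each by the dyadic intervals that
   it touches makes the cover measurable. *)
pose touched j k' := [set m : nat | exists2 y, F k' y &
  0 <= y /\ y * (2 ^ j)%:R \in `[m%:R, m.+1%:R[].
pose V j k' := \bigcup_(m in touched j k') [set x : R | x * (2 ^ j)%:R \in `[m%:R, m.+1%:R[].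
have mV j k' : measurable (V j k').
  apply: bigcup_measurable => m _.
  by apply: (@measurable_preimage_itv _ R _ (fun x => x * (2 ^ j)%:R)); exact: measurable_funM.
have mfV j k' : measurable (f @^-1` V j k').
  by rewrite -[X in measurable X]setTI; exact: mf.
have FV j k' : F k' `&` [set x | 0 <= x] `<=` V j k'.
  move=> x [Fx x0]; have xj : 0 <= x * (2 ^ j)%:R by rewrite mulr_ge0.
  have xi : x * (2 ^ j)%:R \in
      `[(Num.truncn (x * (2 ^ j)%:R))%:R, (Num.truncn (x * (2 ^ j)%:R)).+1%:R[.
    by rewrite in_itv/=; exact: truncn_itv.
  by exists (Num.truncn (x * (2 ^ j)%:R)) => //; exists x.
have diam_ge0 k' : (0 <= diam_pow e (F k'))%E.
  by rewrite /diam_pow; case: ifP => // _; exact: poweR_ge0.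
have /choice[js jsP] : forall k', exists j, (s (G `&` f @^-1` V j k') <=
    c%:E * diam_pow e (F k') + (eta / (2 ^ k'.+1)%:R)%:E)%E.
  move=> k'; have [F0|/set0P[y0 Fy0]] := eqVneq (F k') set0.
    exists j0; rewrite (_ : G `&` _ = set0) ?measure0.
      apply: adde_ge0; last by rewrite lee_fin divr_ge0// ltW.
      by apply: mule_ge0 => //; rewrite lee_fin ltW.
    by apply/seteqP; split => // z [_ [m [y]]]; rewrite F0.
  have dF y y' : F k' y -> F k' y' -> (`|y - y'|%:E <= diam (F k'))%E.
    by move=> Fy Fy'; apply: ereal_sup_ubound; exists (y, y').
  have d0 : (0 <= diam (F k'))%E.
    by apply: le_trans (dF _ _ Fy0 Fy0); rewrite lee_fin.
  have dfin : diam (F k') \is a fin_num.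
    by rewrite ge0_fin_numE// (le_lt_trans (Fd k'))// ltry.
  pose r := fine (diam (F k')).
  have rE : diam (F k') = r%:E by rewrite fineK.
  have r01 : 0 <= r <= (2 ^ j0)%:R^-1 by rewrite -!lee_fin -rE d0 Fd.
  (* The slack of the scale is incurred once for each of the three cells. *)
  have eta1 : 0 < eta / (2 ^ k'.+1)%:R / 3 by rewrite !divr_gt0.
  have [j [jj0 rj je]] := dyadic_scale e0 r01 eta1.
  exists j.
  have -> : diam_pow e (F k') = (r `^ e)%:E.
    by rewrite /diam_pow ifF ?rE// ; apply/negP => /eqP F0; rewrite F0 in Fy0.
  rewrite -EFinM -EFinD -[leLHS]fineK ?fin_num_measure//; last exact: measurableI.
  rewrite lee_fin.
  have M0 : (0 < 2 ^ j)%N by rewrite expn_gt0.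
  pose J (m : nat) := `[< touched j k' m >] && ~~ heavy j m.
  have mGV : measurable (G `&` f @^-1` V j k') by exact: measurableI.
  have GVB : G `&` f @^-1` V j k' `<=` B by move=> z [/GB].
  have uniqm (x : R) m : 0 <= x -> x \in `[m%:R, m.+1%:R[ -> Num.truncn x = m.
    by move=> x0; rewrite in_itv/= => xm; apply/eqP; rewrite truncn_eq.
  have GVJ z : (G `&` f @^-1` V j k') z -> J (Num.truncn (f z * (2 ^ j)%:R)).
    move=> [Gz [m tm /= zm]]; have /andP[z0 _] := fB (GB _ Gz).
    rewrite /J; apply/andP; split; last by apply/negP; exact: Glight.
    by apply/asboolP; rewrite (uniqm _ m)// mulr_ge0.
  apply: (le_trans (measure_le_cells M0 mGV GVB GVJ)).
  have [[y1 [Fy1 y10]]|nopos] := pselect (exists y, F k' y /\ 0 <= y); last first.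
    rewrite big1 => [|m].
      apply: addr_ge0; first by apply: mulr_ge0; [exact: ltW|exact: powR_ge0].
      by apply: divr_ge0; [exact: ltW|].
    rewrite inE => /andP[/asboolP[y Fy [y0_ge0 _]] _].
    by case: nopos; exists y.
  pose m1 := Num.truncn (y1 * (2 ^ j)%:R).
  have J3 : (#|[pred m : 'I_(k * 2 ^ j) | J m]| <= 3)%N.
    (* Only the indices [m1 - 1], [m1] and [m1 + 1] can occur. For [m1 = 0] the natural predecessor
       is 0 and the window still contains them. *)
    apply: leq_trans (card_itv_ord_le (k * 2 ^ j) m1.-1 3).
    apply: subset_leq_card; apply/fintype.subsetP => m; rewrite !inE.
    move=> /andP[/asboolP[y Fy [y_ge0 ym]] _].
    have yM : 0 <= y * (2 ^ j)%:R by rewrite mulr_ge0.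
    have y1M : 0 <= y1 * (2 ^ j)%:R by rewrite mulr_ge0.
    have /andP[h1 h2] := truncn_itv y1M.
    have yy1 : `|y * (2 ^ j)%:R - y1 * (2 ^ j)%:R| <= 1.
      rewrite -mulrBl normrM (ger0_norm (ltW (p2 j))) -ler_pdivlMr// mul1r.
      by rewrite (le_trans _ rj)// -lee_fin -rE; exact: dF.
    move: ym h1 h2 yy1; rewrite in_itv/= -/m1 ler_norml => /andP[a1 a2] h1 h2 /andP[b1 b2].
    have c1 : (m < m1.+2)%N.
      rewrite -(ltr_nat R) (le_lt_trans a1)// -natr1; lra.
    have c3 : (m1 < m.+2)%N.
      rewrite -(ltr_nat R) (le_lt_trans h1)// -natr1; lra.
    case: (m1) c1 c3 => [|n] c1 c3 /=; first by rewrite (leq_trans c1).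
    by rewrite addn3 c1 andbT -ltnS.
  apply: (@le_trans _ _ (\sum_(m in [pred m : 'I_(k * 2 ^ j) | J m]) (2 ^ j)%:R `^ (- e))).
    by apply: ler_sum => m; rewrite inE => /andP[_]; rewrite /heavy -leNgt.
  rewrite sumr_const.
  apply: (@le_trans _ _ (3 * (2 ^ j)%:R `^ (- e))).
    by rewrite -[leLHS]mulr_natl ler_wpM2r ?powR_ge0// ler_nat.
  rewrite (le_trans (ler_wpM2l _ je))// /c le_eqVlt; apply/orP; left; apply/eqP.
  by field; rewrite pnatr_eq0 expn_eq0.
pose W := \bigcup_k' V (js k') k'.
have mW : measurable W by exact: bigcup_measurable.
have DW : D `<=` W.
  by move=> x Dx; have [k' _ Fx] := DF x Dx; exists k' => //; apply: FV; split => //; exact: Dge0.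
have mfW : measurable (f @^-1` W) by rewrite -[X in measurable X]setTI; exact: mf.
have GW0 : s (G `\` f @^-1` W) = 0%E.
  apply/eqP; rewrite eq_le measure_ge0 andbT -(cov W mW DW).
  by apply: le_measure; rewrite ?inE; [exact: measurableD|exact: measurableD|exact: setSD].
have : (s G <= (c * eta + eta)%:E)%E.
  rewrite [leLHS](measureDI s mG mfW) [X in (X + _)%E]GW0 add0e.
  rewrite /W preimage_bigcup setI_bigcupr.
  have mGV i : measurable (G `&` f @^-1` V (js i) i) by exact: measurableI.
  apply: (le_trans (@generalized_Boole_inequality _ _ _ s _ mGV (bigcupT_measurable _ mGV))).
  apply: (@le_trans _ _ (\sum_(i <oo) (c%:E * diam_pow e (F i) + (eta / (2 ^ i.+1)%:R)%:E))%E).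
    by apply: lee_nneseries => // i _; exact: jsP.
  apply: (le_trans (epsilon_trick xpredT _ _)) => //.
  - by move=> i; rewrite mule_ge0// lee_fin ltW.
  - exact: ltW.
  rewrite EFinD leeD2r// nneseriesZl//.
  rewrite [(c * eta)%:E]EFinM; apply: lee_wpmul2l; [by rewrite lee_fin ltW|exact: ltW].
rewrite -[leLHS]fineK ?fin_num_measure// lee_fin.
have -> : c * eta + eta = fine (s G) - eta.
  by rewrite /eta; field; rewrite gt_eqF.
by lra.
Qed.

End hausdorff.

End distances.

(** * From measures on X to its distance set *)

Section distance_sets.
Context {R : realType} {n : nat}.
Local Notation E := (borelRd R n.+1).
Implicit Types mu nu : {finite_measure set E -> \bar R}.

(** A pair whose distance avoids [V] has a component outside the corresponding support, and such
    pairs form a null set of the product. *)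
Lemma diff_measure_distances0 mu nu (X : set 'rV[R]_n.+1) (V : set R) :
  spt mu `<=` X -> spt nu `<=` X -> measurable V -> distance_set X `<=` V ->
  diff_measure mu nu (~` ((fun z : E => enorm z) @^-1` V)) = 0%E.
Proof.
move=> muX nuX mV DV; rewrite /diff_measure /pushforward.
pose N1 : set (E * E) := ~` (spt mu : set E) `*` setT.
pose N2 : set (E * E) := setT `*` ~` (spt nu : set E).
have m1 : measurable (~` (spt mu : set E)) by apply: measurableC; exact: measurable_spt.
have m2 : measurable (~` (spt nu : set E)) by apply: measurableC; exact: measurable_spt.
have mN1 : measurable N1 by exact: measurableX.
have mN2 : measurable N2 by exact: measurableX.
have N10 : finite_prod mu nu N1 = 0%E.
  by rewrite /finite_prod product_measure1E// measure_setC_spt mul0e.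
have N20 : finite_prod mu nu N2 = 0%E.
  by rewrite /finite_prod product_measure1E// measure_setC_spt mule0.
set W := rowB @^-1` _.
have mW : measurable W.
  rewrite -[W]setTI; apply: measurable_rowB_prod => //; apply: measurableC.
  by rewrite -[X in measurable X]setTI; exact: measurable_enorm_id.
apply/eqP; rewrite eq_le measure_ge0 andbT.
have WN : W `<=` N1 `|` N2.
  move=> [x y] /= Wxy; apply: contrapT => /not_orP[/= n1 n2]; apply: Wxy; apply: DV.
  exists (x, y) => //; split => /=.
    by apply: muX; apply: contrapT => nx; apply: n1.
  by apply: nuX; apply: contrapT => ny; apply: n2.
change (finite_prod mu nu W <= 0)%E.
apply: (@le_trans _ _ (finite_prod mu nu (N1 `|` N2))).
  by apply: le_measure; rewrite ?inE//; exact: measurableU.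
apply: (@le_trans _ _ (finite_prod mu nu N1 + finite_prod mu nu N2)%E); first exact: measureU2.
by rewrite N10 N20 adde0.
Qed.

(** Any [p] in [[0, 1]] with [p >= d - a - b] is allowed, so one statement serves both conclusions;
    the cell estimates are applied with [t = 1 - p]. *)
Lemma distance_set_bounds (X : set 'rV[R]_n.+1) mu nu (theta a b p : R) :
  mu setT <> 0%E -> nu setT <> 0%E -> spt mu `<=` X -> spt nu `<=` X ->
  0 <= theta <= 1 -> tail_finite mu theta a -> tail_finite nu (1 - theta) b ->
  0 <= p <= 1 -> - p <= a + b - n.+1%:R ->
  (p = 0 -> (0 < @lebesgue_measure R (distance_set X))%E) /\
  (forall e, 0 <= e -> e < 1 - p -> hausdorff_measure e (distance_set X) <> 0%E).
Proof.
move=> mu0 nu0 muX nuX th Ha Hb p01 pab.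
have Ioo : (\int[@lebesgue_Rd R n.+1]_(z in [set z | (1 <= enorm z)%R])
    (abs_fourier (diff_measure mu nu) z ^+ 2 * enorm z `^ (- p))%:E < +oo)%E.
  under eq_integral do rewrite abs_fourier_diff_measure.
  exact: tail_finite_mul pab Ha Hb.
have [C C0 corr] := correlation_le p01 Ioo.
have s0 : (0 < diff_measure mu nu setT)%E.
  rewrite /diff_measure /pushforward preimage_setT -setXTT.
  by rewrite product_measure1E// mule_gt0// lt0e measure_ge0 andbT; exact/eqP.
have [B [k [K [C' [mB sB Bk C'0 cells]]]]] := radial_cells C0 corr s0.
have cov V : measurable V -> distance_set X `<=` V ->
    diff_measure mu nu (B `\` (fun z : E => enorm z) @^-1` V) = 0%E.
  move=> mV DV; have mfV : measurable ((fun z : E => enorm z) @^-1` V).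
    by rewrite -[X in measurable X]setTI; exact: measurable_enorm_id.
  apply/eqP; rewrite eq_le measure_ge0 andbT.
  rewrite -(diff_measure_distances0 muX nuX mV DV); apply: le_measure; rewrite ?inE.
  - exact: measurableD.
  - exact: measurableC.
  - exact: subDsetr.
have fB z : B z -> 0 <= enorm z < k%:R by move=> /Bk ->; rewrite enorm_ge0.
have cells' (M : nat) : (0 < M)%N -> (K <= M)%N ->
    \sum_(m < k * M) fine (diff_measure mu nu
      (B `&` [set z | enorm z * M%:R \in `[m%:R, m.+1%:R[])) ^+ 2
      <= C' * M%:R `^ (- (1 - p)).
  by move=> M0 KM; rewrite opprB; exact: cells.
split=> [p0|e e0 ep].
  have p1 : 1 - p = 1 by rewrite p0 subr0.
  exact: (lebesgue_measure_distances_gt0 measurable_enorm_id mB sB fB C'0 cells' p1 cov).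
apply: (hausdorff_measure_distances_neq0 measurable_enorm_id mB sB fB C'0 cells' e0 ep _ cov).
by move=> _ [[x y] _ <-]; exact: enorm_ge0.
Qed.

Lemma fourier_spectrum_le (X : set 'rV[R]_n.+1) (theta : R) :
  (fourier_spectrum X theta <= n.+1%:R%:E)%E.
Proof. by apply: ge_ereal_sup => _ [mu _ <-]; rewrite ge_min lexx orbT. Qed.

Lemma lt_fourier_spectrum (X : set 'rV[R]_n.+1) (theta a : R) : 0 <= theta <= 1 ->
  (a%:E < fourier_spectrum X theta)%E -> exists mu : {finite_measure set E -> \bar R},
    [/\ mu setT <> 0%E, spt mu `<=` X & tail_finite mu theta a].
Proof.
move=> th /ereal_sup_gt[_ [mu [mu0 muX] <-]]; rewrite lt_min => /andP[amu _].
by exists mu; split => //; exact: lt_spectrum_tail_finite.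
Qed.

Lemma lte_add_split (c D : R) (x y : \bar R) : (x <= D%:E)%E -> (y <= D%:E)%E ->
  (c%:E < x + y)%E -> exists a b : R, [/\ (a%:E < x)%E, (b%:E < y)%E & c < a + b].
Proof.
case: x => [x| |] //; case: y => [y| |] // _ _; rewrite -EFinD lte_fin => cxy.
(* Each summand gives up a third of the excess over [c], so a third remains. *)
by exists (x - (x + y - c) / 3), (y - (x + y - c) / 3); rewrite !lte_fin; split; lra.
Qed.

End distance_sets.

Unset Implicit Arguments.

(* lebesgue_measure is by definition the outer measure extending interval
   length, so its value on a possibly non-measurable set is the outer measure. *)
Theorem theorem7p1 (R : realType) (d : nat) (hd : (0 < d)%N)
    (X : set 'rV[R]_d) (hX : X !=set0) :
  let S : \bar R :=
    ereal_sup [set (fourier_spectrum X theta + fourier_spectrum X (1 - theta))%E |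
               theta in [set theta : R | 0 <= theta <= 1]] in
  ((d%:R%:E < S)%E -> (0 < lebesgue_measure (distance_set X))%E) /\
  (~ (d%:R%:E < S)%E ->
     (1 - d%:R%:E + S <= hausdorff_dim (distance_set X))%E).
Proof.
case: d hd X hX => // n _ X _ S.
have th' (theta : R) : 0 <= theta <= 1 -> 0 <= 1 - theta <= 1.
  by move=> /andP[t0 t1]; rewrite subr_ge0 t1 gerBl.
split.
  move=> /ereal_sup_gt[_ [theta /= th <-]] dS.
  have [a [b [aF bF dab]]] := lte_add_split (fourier_spectrum_le X theta)
    (fourier_spectrum_le X (1 - theta)) dS.
  have [mu [mu0 muX mua]] := lt_fourier_spectrum th aF.
  have [nu [nu0 nuX nub]] := lt_fourier_spectrum (th' _ th) bF.
  have [||H _] := @distance_set_bounds _ _ X _ _ theta a b 0 mu0 nu0 muX nuX th mua nub.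
  - by rewrite lexx ler01.
  - by rewrite oppr0 subr_ge0 ltW.
  exact: H.
move=> /negP; rewrite -leNgt => Sd; apply: le_ereal_inf_tmp => _ [e [e0 He] <-].
(* The dimension is an infimum, so it is enough that every exponent [e] with vanishing Hausdorff
   measure bounds [S] in this way. *)
suff Se : (S <= (e - 1 + n.+1%:R)%:E)%E.
  rewrite -EFinB (le_trans (leeD2l _ Se))// -EFinD lee_fin; lra.
apply: ge_ereal_sup => _ [theta /= th <-]; rewrite leNgt; apply/negP => dS.
have [a [b [aF bF dab]]] := lte_add_split (fourier_spectrum_le X theta)
  (fourier_spectrum_le X (1 - theta)) dS.
have [mu [mu0 muX mua]] := lt_fourier_spectrum th aF.
have [nu [nu0 nuX nub]] := lt_fourier_spectrum (th' _ th) bF.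
(* Here the assumption [S <= d] enters: it makes [p = d - (a + b)] positive, while [dab] gives
   [p < 1 - e]. *)
have abd : a + b < n.+1%:R.
  rewrite -lte_fin EFinD (lt_le_trans (lteD aF bF))// (le_trans _ Sd)//.
  by apply: ereal_sup_ubound; exists theta.
have [||_ H] := @distance_set_bounds _ _ X _ _ theta a b
  (n.+1%:R - (a + b)) mu0 nu0 muX nuX th mua nub.
- by apply/andP; split; lra.
- by lra.
by apply: (H e) He => //; lra.
Qed.
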